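(* Let $\alpha\in(0,1]$ and let $\lambda, c$ be real constants with $c>0$. Let $(L_B)^{\alpha}$ denote the fractional power of the Bessel operator $L_B=\frac{d^2}{dw^2}+\frac{1}{w}\frac{d}{dw}$, defined for functions $f$ of $w>0$ by $$(L_B)^{\alpha}f(w)=4^{\alpha}w^{-2\alpha}\,I_2^{0,-\alpha}\,I_2^{0,-\alpha}f(w).$$ Then the function $$u_{\alpha}(w)=w^{2\alpha-2}\sum_{k=0}^{\infty}(-1)^k\left(\frac{\lambda}{2^{\alpha}c^{\alpha}}\right)^{2k}\frac{w^{2\alpha k}}{[\Gamma(\alpha k+\alpha)]^2},\qquad w>0,$$ satisfies the fractional Bessel equation $$(L_B)^{\alpha}u_{\alpha}(w)=-\frac{\lambda^2}{c^{2\alpha}}u_{\alpha}(w).$$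
   Context: Erdélyi–Kober operators (McBride's notation): for $m>0$, $\eta\in\mathbb{R}$ and $\alpha>0$, $$I_m^{\eta,\alpha}f(x)=\frac{x^{-m\eta-m\alpha}}{\Gamma(\alpha)}\int_0^x(x^m-u^m)^{\alpha-1}u^{m\eta}f(u)\,d(u^m),$$ and for $\alpha\le 0$ they are defined recursively by $$I_m^{\eta,\alpha}f=(\eta+\alpha+1)I_m^{\eta,\alpha+1}f+\frac{1}{m}I_m^{\eta,\alpha+1}\left(x\frac{d}{dx}f\right).$$ This is McBride's definition of fractional powers of the hyper-Bessel operator $x^{a_1}Dx^{a_2}\cdots x^{a_n}Dx^{a_{n+1}}$, specialized to $n=2$, $a_1=-1$, $a_2=1$, $a_3=0$ (so $m=2$ and both parameters $b_1=b_2=0$). *)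

(* Defs.v *)
From Stdlib Require Import Reals Lra ZArith.
From Coquelicot Require Import Coquelicot.
Open Scope R_scope.

Definition Gamma (s : R) : R :=
  RInt_gen (fun t => Rpower t (s - 1) * exp (- t)) (at_right 0) (Rbar_locally p_infty).

(* Erdelyi-Kober operator for alpha > 0 (McBride's notation):
   I_m^{eta,alpha} f (x) = x^{-m eta - m alpha}/Gamma(alpha)
        * int_0^x (x^m - u^m)^{alpha-1} u^{m eta} f(u) d(u^m),
   with d(u^m) = m u^(m-1) du; the integral is taken as an improper
   Riemann integral over the open interval (0, x). *)
Definition EK_pos (m eta alpha : R) (f : R -> R) (x : R) : R :=
  Rpower x (- m * eta - m * alpha) / Gamma alpha *
  RInt_gen (fun u => Rpower (Rpower x m - Rpower u m) (alpha - 1)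
                     * Rpower u (m * eta) * f u * (m * Rpower u (m - 1)))
           (at_right 0) (at_left x).

Definition xD (f : R -> R) : R -> R := fun x => x * Derive f x.

(* n-fold unfolding of the recursive definition
   I^{eta,alpha} f = (eta+alpha+1) I^{eta,alpha+1} f + (1/m) I^{eta,alpha+1}(x f') *)
Fixpoint EK_iter (n : nat) (m eta alpha : R) (f : R -> R) : R -> R :=
  match n with
  | O => EK_pos m eta alpha f
  | S n' => fun x => (eta + alpha + 1) * EK_iter n' m eta (alpha + 1) f x
                     + / m * EK_iter n' m eta (alpha + 1) (xD f) x
  end.

(* Number of recursion steps: the least n with alpha + n > 0 (0 if alpha > 0). *)
Definition EK_steps (alpha : R) : nat := Z.to_nat (up (- alpha)).

Definition EK (m eta alpha : R) (f : R -> R) : R -> R :=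
  EK_iter (EK_steps alpha) m eta alpha f.

Definition LB_frac (alpha : R) (f : R -> R) (w : R) : R :=
  Rpower 4 alpha * Rpower w (-2 * alpha) * EK 2 0 (- alpha) (EK 2 0 (- alpha) f) w.

Definition u_sol (alpha lambda c : R) (w : R) : R :=
  Rpower w (2 * alpha - 2) *
  Series (fun k => (-1) ^ k * (lambda / (Rpower 2 alpha * Rpower c alpha)) ^ (2 * k)
                   * Rpower w (2 * alpha * INR k) / (Gamma (alpha * INR k + alpha)) ^ 2).

(* Main.v *)
Require Import Defs.
From Stdlib Require Import Reals ZArith Lra Lia.
From Coquelicot Require Import Coquelicot.
Open Scope R_scope.

(* The operator [I_2^{0,-alpha}] acts diagonally on series in [w^(2 alpha k + 2 alpha - 2)]:
   it multiplies the k-th coefficient by [Gamma (alpha k + alpha) / Gamma (alpha k)], read as 0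
   for k = 0.  Applied twice to [u_alpha] it kills the first term and cancels the squared
   Gamma factors, which leaves the same series with its index shifted by one.
   The multiplier comes from the Beta integral.  Its value is obtained without double integrals,
   from the recurrence in the second parameter, monotonicity, and Wendel's bounds for Gamma.
   Sum and improper integral may be exchanged because the power series converges uniformly
   against an integrable weight. *)

(** The obstacle is the negative order: $I_2^{0,-\alpha}$ is not an integral but a recursion through
    orders raised by one and the derivation $x\,d/dx$. Put $x_k=\alpha k+\alpha$. On $w^{2x_k-2}$
    the derivation has eigenvalue $2(x_k-1)$, so one recursion step at order $a$ contributes the
    factor $x_k+a$, exactly what turns $\Gamma(x_k)/\Gamma(x_k+a+1)$ into
    $\Gamma(x_k)/\Gamma(x_k+a)$. For $a=-\alpha$ and $k=0$ this factor is 0 and stands for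
    $1/\Gamma(0)$, so Gamma is only ever evaluated at positive arguments. The recursion ends at an
    order in $(0,1]$, and only such orders are integrated. Both the power of $u$ and the kernel may
    then be unbounded at their ends of $(0,w)$, hence the improper integrals and the weighted form
    of the limit theorem. *)

(** * Improper integrals with two open ends *)

(* [Fa] and [Fb] approach the left and the right end of the interval [D]; this treats
   (0, w) and (0, +oo) alike. *)
Record improper_ends (D : R -> Prop) (Fa Fb : (R -> Prop) -> Prop) : Prop := {
  ends_left : ProperFilter Fa;
  ends_right : ProperFilter Fb;
  ends_convex : forall x y z, D x -> D y -> x <= z <= y -> D z;
  ends_split : exists x0, D x0 /\ Fa (fun x => D x /\ x <= x0)
                          /\ Fb (fun x => D x /\ x0 <= x) }.

Lemma ends_prod D Fa Fb : improper_ends D Fa Fb ->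
  filter_prod Fa Fb (fun ab => D (fst ab) /\ D (snd ab) /\ fst ab <= snd ab).
Proof.
  intros [PFa PFb Hc [x0 [H0 [Ha Hb]]]].
  apply (Filter_prod _ _ _ _ _ Ha Hb).
  simpl; intros x y [? ?] [? ?]; repeat split; auto; lra.
Qed.

Lemma improper_ends_0_infty :
  improper_ends (fun x => 0 < x) (at_right 0) (Rbar_locally p_infty).
Proof.
  split; try apply _.
  - intros; lra.
  - exists 1; split; [lra | split].
    + exists (mkposreal 1 Rlt_0_1); intros y Hy H0.
      apply Rabs_def2 in Hy; unfold minus, plus, opp in Hy; simpl in Hy; lra.
    + exists 1; intros; lra.
Qed.

Lemma improper_ends_0_left w : 0 < w ->
  improper_ends (fun x => 0 < x < w) (at_right 0) (at_left w).
Proof.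
  intros Hw; assert (Hw2 : 0 < w / 2) by lra; split; try apply _.
  - intros; lra.
  - exists (w / 2); split; [lra | split].
    + exists (mkposreal _ Hw2); intros y Hy H0.
      apply Rabs_def2 in Hy; unfold minus, plus, opp in Hy; simpl in Hy; lra.
    + exists (mkposreal _ Hw2); intros y Hy H0.
      apply Rabs_def2 in Hy; unfold minus, plus, opp in Hy; simpl in Hy; lra.
Qed.

Lemma ex_RInt_ends D Fa Fb (f : R -> R) a b : improper_ends D Fa Fb ->
  (forall x, D x -> continuous f x) -> D a -> D b -> a <= b -> ex_RInt f a b.
Proof.
  intros HD Hf Ha Hb Hab; apply (ex_RInt_continuous (V := R_CompleteNormedModule)); intros z Hz.
  rewrite Rmin_left, Rmax_right in Hz by lra.
  apply Hf; exact (ends_convex _ _ _ HD _ _ _ Ha Hb Hz).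
Qed.

Lemma filterlim_increment D Fa Fb (F : R -> R) la lb : improper_ends D Fa Fb ->
  filterlim F Fa (locally la) -> filterlim F Fb (locally lb) ->
  filterlim (fun ab => F (snd ab) - F (fst ab)) (filter_prod Fa Fb) (locally (lb - la)).
Proof.
  intros HD Ha Hb; pose proof (ends_left _ _ _ HD); pose proof (ends_right _ _ _ HD).
  apply (filterlim_comp_2 (G := locally lb) (H := locally (opp la))
           (fun ab => F (snd ab)) (fun ab => opp (F (fst ab))) plus).
  - apply (filterlim_comp _ _ _ snd F _ Fb); [apply filterlim_snd | exact Hb].
  - apply (filterlim_comp _ _ _ (fun ab => F (fst ab)) opp _ (locally la)).
    + apply (filterlim_comp _ _ _ fst F _ Fa); [apply filterlim_fst | exact Ha].
    + apply (filterlim_opp (V := R_NormedModule)).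
  - apply (filterlim_plus (V := R_NormedModule)).
Qed.

Lemma is_RInt_gen_antiderivative D Fa Fb (F f : R -> R) la lb : improper_ends D Fa Fb ->
  (forall x, D x -> is_derive F x (f x)) -> (forall x, D x -> continuous f x) ->
  filterlim F Fa (locally la) -> filterlim F Fb (locally lb) ->
  is_RInt_gen f Fa Fb (lb - la).
Proof.
  intros HD HF Hf Ha Hb P HP.
  pose proof (ends_left _ _ _ HD); pose proof (ends_right _ _ _ HD).
  pose proof (filterlim_increment _ _ _ _ _ _ HD Ha Hb P HP) as HI.
  unfold filtermap in HI; unfold filtermapi.
  generalize (filter_and _ _ HI (ends_prod _ _ _ HD)); apply filter_imp.
  intros [a b]; simpl; intros [HPab [Da [Db Hab]]].
  exists (F b - F a); split; [ | exact HPab].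
  apply (is_RInt_derive (V := R_CompleteNormedModule)); intros x Hx;
    rewrite Rmin_left, Rmax_right in Hx by lra;
    pose proof (ends_convex _ _ _ HD _ _ _ Da Db Hx); auto.
Qed.

Lemma is_RInt_gen_close Fa Fb (f : R -> R) l : is_RInt_gen f Fa Fb l ->
  forall eps : posreal, filter_prod Fa Fb (fun ab => exists y,
    is_RInt f (fst ab) (snd ab) y /\ Rabs (y - l) < eps).
Proof.
  intros H eps; apply (H (fun y => Rabs (y - l) < eps)); exists eps; intros y Hy; exact Hy.
Qed.

(** Increments of the integral of [f] from a base point are bounded by increments of [G], so the
    Cauchy criterion passes from [G] to that integral at each end. Asking for a primitive [G] with
    finite limits makes every majorant an explicit formula. *)
Lemma ex_RInt_gen_dominated D Fa Fb (f G g : R -> R) la lb : improper_ends D Fa Fb ->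
  (forall x, D x -> continuous f x) ->
  (forall x, D x -> is_derive G x (g x)) -> (forall x, D x -> continuous g x) ->
  (forall x, D x -> Rabs (f x) <= g x) ->
  filterlim G Fa (locally la) -> filterlim G Fb (locally lb) ->
  ex_RInt_gen f Fa Fb.
Proof.
  intros HD Hf HG Hg Hfg Ha Hb.
  pose proof (ends_left _ _ _ HD); pose proof (ends_right _ _ _ HD).
  destruct (ends_split _ _ _ HD) as [x0 [D0 [Sa Sb]]].
  assert (ex : forall a b, D a -> D b -> ex_RInt f a b).
  { intros a b Da Db; destruct (Rle_dec a b).
    - exact (ex_RInt_ends _ _ _ _ _ _ HD Hf Da Db r).
    - apply ex_RInt_swap; apply (ex_RInt_ends _ _ _ _ _ _ HD Hf Db Da); lra. }
  assert (Hle : forall a b, D a -> D b -> a <= b ->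
            Rabs (RInt f x0 b - RInt f x0 a) <= Rabs (G b - G a)).
  { intros a b Da Db Hab.
    assert (Hig : is_RInt g a b (G b - G a)).
    { apply (is_RInt_derive (V := R_CompleteNormedModule)); intros x Hx;
      rewrite Rmin_left, Rmax_right in Hx by lra;
      pose proof (ends_convex _ _ _ HD _ _ _ Da Db Hx); auto. }
    assert (Hif : is_RInt f a b (RInt f x0 b - RInt f x0 a)).
    { replace (RInt f x0 b - RInt f x0 a) with (RInt f a b).
      - apply (RInt_correct (V := R_CompleteNormedModule)); auto.
      - rewrite <- (RInt_Chasles f x0 a b) by auto; unfold plus; simpl; lra. }
    apply Rle_trans with (2 := Rle_abs _).
    apply (norm_RInt_le (V := R_NormedModule) f g a b _ _ Hab); auto.
    intros x Hx; apply Hfg; exact (ends_convex _ _ _ HD _ _ _ Da Db Hx). }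
  assert (Hlim : forall F : (R -> Prop) -> Prop, ProperFilter F -> F D ->
     forall l, filterlim G F (locally l) -> exists y, filterlim (RInt f x0) F (locally y)).
  { intros F PF FD l Hl.
    apply (filterlim_locally_cauchy (U := R_CompleteSpace)); intros eps.
    destruct (proj2 (filterlim_locally_cauchy (U := R_CompleteSpace) G) (ex_intro _ l Hl) eps)
      as [P [FP HP]].
    exists (fun x => P x /\ D x); split; [apply filter_and; auto | ].
    intros u v [Pu Du] [Pv Dv].
    assert (K : Rabs (G v - G u) < eps) by (exact (HP _ _ Pu Pv)).
    change (Rabs (RInt f x0 v - RInt f x0 u) < eps).
    destruct (Rle_dec u v) as [h | h].
    - apply Rle_lt_trans with (2 := K); auto.
    - rewrite Rabs_minus_sym; rewrite Rabs_minus_sym in K.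
      apply Rle_lt_trans with (2 := K); apply Hle; auto; lra. }
  destruct (Hlim Fa _ (filter_imp _ _ (fun x => @proj1 _ _) Sa) _ Ha) as [ya Hya].
  destruct (Hlim Fb _ (filter_imp _ _ (fun x => @proj1 _ _) Sb) _ Hb) as [yb Hyb].
  exists (yb - ya); intros P HP.
  pose proof (filterlim_increment _ _ _ _ _ _ HD Hya Hyb P HP) as HI.
  unfold filtermap in HI; unfold filtermapi.
  generalize (filter_and _ _ HI (ends_prod _ _ _ HD)); apply filter_imp.
  intros [a b]; simpl; intros [HPab [Da [Db Hab]]].
  exists (RInt f x0 b - RInt f x0 a); split; [ | exact HPab].
  replace (RInt f x0 b - RInt f x0 a) with (RInt f a b).
  - apply (RInt_correct (V := R_CompleteNormedModule)); auto.
  - rewrite <- (RInt_Chasles f x0 a b) by auto; unfold plus; simpl; lra.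
Qed.

(** On $[a,b]$ the integrals of [f] and [fn n] differ by at most [eps n] times the integral of [W],
    which stays bounded as the ends are approached; the error is therefore uniform in $a,b$ although
    the functions may be unbounded there. *)
Lemma is_RInt_gen_weighted_limit D Fa Fb (f W : R -> R) (fn : nat -> R -> R)
    (eps Ln : nat -> R) (lW L : R) : improper_ends D Fa Fb ->
  (forall x, D x -> continuous f x) ->
  is_RInt_gen W Fa Fb lW -> (forall n, is_RInt_gen (fn n) Fa Fb (Ln n)) ->
  is_lim_seq Ln L -> is_lim_seq eps 0 ->
  (forall n x, D x -> Rabs (f x - fn n x) <= eps n * W x) ->
  is_RInt_gen f Fa Fb L.
Proof.
  intros HD Hf HW Hfn HLn Heps Hle P [e HP].
  pose proof (ends_left _ _ _ HD); pose proof (ends_right _ _ _ HD).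
  (* [M] bounds the integral of [W] over $[a,b]$ once it is within 1 of its limit. The three thirds
     of [e] pay for replacing [f] by [fn N], for the ends, and for [Ln N] against [L]. *)
  pose (M := Rabs lW + 1).
  assert (HM : 0 < M) by (unfold M; pose proof (Rabs_pos lW); lra).
  assert (He3 : 0 < e / 3) by (destruct e; simpl; lra).
  assert (He3M : 0 < e / 3 / M) by (apply Rdiv_lt_0_compat; lra).
  apply is_lim_seq_spec in HLn; apply is_lim_seq_spec in Heps; unfold is_lim_seq' in HLn, Heps.
  destruct (HLn (mkposreal _ He3)) as [N1 HN1].
  destruct (Heps (mkposreal _ He3M)) as [N2 HN2].
  pose (N := Nat.max N1 N2).
  specialize (HN1 N (Nat.le_max_l _ _)); specialize (HN2 N (Nat.le_max_r _ _)).
  simpl in HN1, HN2; rewrite Rminus_0_r in HN2.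
  unfold filtermapi.
  generalize (filter_and _ _ (filter_and _ _ (is_RInt_gen_close _ _ _ _ HW (mkposreal 1 Rlt_0_1))
    (is_RInt_gen_close _ _ _ _ (Hfn N) (mkposreal _ He3))) (ends_prod _ _ _ HD)).
  apply filter_imp; intros [a b]; simpl.
  intros [[[yW [HyW HyW1]] [yN [HyN HyN1]]] [Da [Db Hab]]].
  pose proof (ex_RInt_ends _ _ _ _ _ _ HD Hf Da Db Hab) as exf.
  exists (RInt f a b); split; [apply (RInt_correct (V := R_CompleteNormedModule)); auto | ].
  apply HP; change (Rabs (RInt f a b - L) < e).
  assert (K : Rabs (RInt f a b - yN) <= eps N * yW).
  { apply (norm_RInt_le (V := R_NormedModule) (fun x => f x - fn N x) (fun x => eps N * W x) a b _ _ Hab).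
    - intros x Hx; apply Hle; exact (ends_convex _ _ _ HD _ _ _ Da Db Hx).
    - apply (is_RInt_minus (V := R_NormedModule)); auto.
      apply (RInt_correct (V := R_CompleteNormedModule)); auto.
    - apply (is_RInt_scal (V := R_NormedModule)); auto. }
  assert (KW : Rabs yW <= M).
  { replace yW with ((yW - lW) + lW) by ring; unfold M.
    pose proof (Rabs_triang (yW - lW) lW); lra. }
  assert (K2 : eps N * yW <= e / 3).
  { apply Rle_trans with (1 := Rle_abs _); rewrite Rabs_mult.
    replace (e / 3) with (e / 3 / M * M) by (field; lra).
    apply Rmult_le_compat; try apply Rabs_pos; lra. }
  replace (RInt f a b - L) with ((RInt f a b - yN) + ((yN - Ln N) + (Ln N - L))) by ring.
  pose proof (Rabs_triang (RInt f a b - yN) ((yN - Ln N) + (Ln N - L))).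
  pose proof (Rabs_triang (yN - Ln N) (Ln N - L)).
  lra.
Qed.

Lemma is_RInt_gen_ext_ends D Fa Fb (f g : R -> R) l : improper_ends D Fa Fb ->
  (forall x, D x -> f x = g x) -> is_RInt_gen f Fa Fb l -> is_RInt_gen g Fa Fb l.
Proof.
  intros HD Hfg; pose proof (ends_left _ _ _ HD); pose proof (ends_right _ _ _ HD).
  apply is_RInt_gen_ext; generalize (ends_prod _ _ _ HD); apply filter_imp.
  intros [a b]; simpl; intros [Da [Db Hab]] x Hx.
  rewrite Rmin_left, Rmax_right in Hx by lra.
  apply Hfg, (ends_convex _ _ _ HD _ _ _ Da Db); lra.
Qed.

(** If [lg < lf], some proper integral of the nonnegative [g - f] would lie within [lf - lg] of
    [lg - lf] and so be negative. *)
Lemma is_RInt_gen_le_ends D Fa Fb (f g : R -> R) lf lg : improper_ends D Fa Fb ->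
  (forall x, D x -> f x <= g x) -> is_RInt_gen f Fa Fb lf -> is_RInt_gen g Fa Fb lg ->
  lf <= lg.
Proof.
  intros HD Hfg Hf Hg; pose proof (ends_left _ _ _ HD); pose proof (ends_right _ _ _ HD).
  assert (H1 : is_RInt_gen (fun x => g x - f x) Fa Fb (lg - lf))
    by (apply (is_RInt_gen_minus (V := R_NormedModule)); auto).
  apply Rnot_lt_le; intros Hlt.
  assert (He : 0 < lf - lg) by lra.
  destruct (filter_ex _ (filter_and _ _ (is_RInt_gen_close _ _ _ _ H1 (mkposreal _ He))
    (ends_prod _ _ _ HD))) as [[a b] [[y [Hy Hy1]] [Da [Db Hab]]]]; simpl in *.
  apply Rabs_def2 in Hy1.
  assert (0 <= y); [ | lra].
  rewrite <- (is_RInt_unique _ _ _ _ Hy).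
  apply RInt_ge_0; [lra | exists y; exact Hy | ].
  intros x Hx; assert (D x) by (apply (ends_convex _ _ _ HD _ _ _ Da Db); lra).
  specialize (Hfg x H2); simpl in *; lra.
Qed.

(** * Limits and inequalities for real powers *)

Lemma filterlim_Rplus {T} (F : (T -> Prop) -> Prop) {FF : Filter F} (f g : T -> R) a b :
  filterlim f F (locally a) -> filterlim g F (locally b) ->
  filterlim (fun x => f x + g x) F (locally (a + b)).
Proof.
  intros Hf Hg; exact (filterlim_comp_2 _ _ _ Hf Hg (filterlim_plus (V := R_NormedModule) a b)).
Qed.

Lemma filterlim_Rmult {T} (F : (T -> Prop) -> Prop) {FF : Filter F} (f g : T -> R) a b :
  filterlim f F (locally a) -> filterlim g F (locally b) ->
  filterlim (fun x => f x * g x) F (locally (a * b)).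
Proof.
  intros Hf Hg; exact (filterlim_comp_2 _ _ _ Hf Hg (filterlim_mult (K := R_AbsRing) a b)).
Qed.

Lemma filterlim_within_continuous (P : R -> Prop) (f : R -> R) (x : R) :
  continuous f x -> filterlim f (within P (locally x)) (locally (f x)).
Proof.
  intros H Q HQ; apply filter_le_within; exact (H Q HQ).
Qed.

Lemma Rpower_pos x y : 0 < Rpower x y.
Proof. apply exp_pos. Qed.

Lemma exp_le_mono x y : x <= y -> exp x <= exp y.
Proof. intros [H | ->]; [left; apply exp_increasing, H | right; reflexivity]. Qed.

Lemma Rpower_minus_1 x s : 0 < x -> Rpower x (s - 1) = Rpower x s / x.
Proof.
  intros Hx; unfold Rminus; rewrite Rpower_plus, Rpower_Ropp, Rpower_1 by exact Hx; reflexivity.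
Qed.

Lemma Rpower_2 x : 0 < x -> Rpower x 2 = x ^ 2.
Proof. intros Hx; rewrite <- Rpower_pow by exact Hx; f_equal; simpl; ring. Qed.

Lemma is_derive_Rpower s x : 0 < x ->
  is_derive (fun t => Rpower t s) x (s * Rpower x (s - 1)).
Proof.
  intros Hx; rewrite Rpower_minus_1 by exact Hx; unfold Rpower.
  auto_derive; [exact Hx | field; lra].
Qed.

Lemma continuous_Rpower s x : 0 < x -> continuous (fun t => Rpower t s) x.
Proof.
  intros Hx; apply (ex_derive_continuous (V := R_NormedModule)).
  eexists; apply is_derive_Rpower, Hx.
Qed.

Lemma filterlim_Rpower_at_right_0 s : 0 < s ->
  filterlim (fun t => Rpower t s) (at_right 0) (locally 0).
Proof.
  intros Hs; apply filterlim_locally; intros [e He].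
  exists (mkposreal _ (Rpower_pos e (/ s))); simpl; intros t Ht Ht0.
  change (Rabs (t - 0) < Rpower e (/ s)) in Ht; change (Rabs (Rpower t s - 0) < e).
  rewrite Rminus_0_r in *; rewrite Rabs_pos_eq in Ht by lra.
  rewrite Rabs_pos_eq by (left; apply Rpower_pos).
  replace e with (Rpower (Rpower e (/ s)) s).
  - apply Rlt_Rpower_l; lra.
  - rewrite Rpower_mult, Rinv_l, Rpower_1; lra.
Qed.

(** A power is monotone in its base, in a direction given by the sign of [e]; the sum of both
    endpoint values serves either case. *)
Lemma Rpower_le_sum e a x c : 0 < a -> a <= x <= c ->
  Rpower x e <= Rpower a e + Rpower c e.
Proof.
  intros Ha Hx; pose proof (Rpower_pos a e); pose proof (Rpower_pos c e).
  destruct (Rle_dec 0 e) as [He | He].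
  - pose proof (Rle_Rpower_l x c e He ltac:(lra)); lra.
  - assert (Rpower x e <= Rpower a e); [ | lra].
    unfold Rpower; apply exp_le_mono.
    destruct (proj1 Hx) as [Hax | <-]; [ | lra].
    pose proof (ln_increasing _ _ Ha Hax); nra.
Qed.

(** This is $1+\ln z\le z$ at $z=y/p$, multiplied by $p$ and exponentiated. *)
Lemma Rpower_le_exp p y : 0 < p -> 0 < y -> Rpower y p <= Rpower p p * exp (y - p).
Proof.
  intros Hp Hy; unfold Rpower; rewrite <- exp_plus; apply exp_le_mono.
  assert (Hyp : 0 < y / p) by (apply Rdiv_lt_0_compat; lra).
  pose proof (exp_ineq1_le (ln (y / p))) as H; rewrite exp_ln in H by exact Hyp.
  unfold Rdiv in H at 1; rewrite ln_mult, ln_Rinv in H by (try apply Rinv_0_lt_compat; lra).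
  apply Rmult_le_compat_l with (r := p) in H; [ | lra].
  replace (p * (y / p)) with y in H by (field; lra); lra.
Qed.

(** Convexity of exp: the tangent at $\theta\ln z$ lies below exp at $0$ and at $\ln z$, and the
    weights $1-\theta$ and $\theta$ cancel the linear terms. *)
Lemma Rpower_Bernoulli z th : 0 < z -> 0 <= th <= 1 -> Rpower z th <= 1 - th + th * z.
Proof.
  intros Hz Hth; unfold Rpower; rewrite <- (exp_ln z) at 2 by exact Hz.
  set (L := ln z); set (E := exp (th * L)).
  assert (HE : 0 < E) by apply exp_pos.
  assert (H1 : exp L = E * exp ((1 - th) * L)) by (unfold E; rewrite <- exp_plus; f_equal; ring).
  assert (H2 : 1 = E * exp (- th * L))
    by (unfold E; rewrite <- exp_plus, <- exp_0; f_equal; ring).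
  pose proof (exp_ineq1_le ((1 - th) * L)); pose proof (exp_ineq1_le (- th * L)).
  assert (E * (1 + (1 - th) * L) <= exp L) by (rewrite H1; apply Rmult_le_compat_l; lra).
  assert (E * (1 + - th * L) <= 1) by (apply Rle_trans with (2 := Req_le _ _ (eq_sym H2)); apply Rmult_le_compat_l; lra).
  nra.
Qed.

(** * The Gamma integral, its functional equation and Wendel's bounds *)

Definition Gamma_integrand (s t : R) : R := Rpower t (s - 1) * exp (- t).

Lemma Gamma_integrand_pos s t : 0 < Gamma_integrand s t.
Proof. apply Rmult_lt_0_compat; apply exp_pos. Qed.

Lemma continuous_Gamma_integrand s t : 0 < t -> continuous (Gamma_integrand s) t.
Proof.
  intros Ht; apply (continuous_mult (K := R_AbsRing)).
  - apply continuous_Rpower, Ht.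
  - apply continuous_exp_comp, (continuous_opp (V := R_NormedModule)), continuous_id.
Qed.

(** [Rpower_le_exp] at $y=1+t$, $p=s+1$. The shift by 1 keeps the bound finite at $t=0$. *)
Lemma Gamma_tail_bound s : 0 < s -> exists C, 0 < C /\
  forall t, 0 < t -> exp (- t) <= C * Rpower (1 + t) (- (s + 1)).
Proof.
  intros Hs; exists (Rpower (s + 1) (s + 1) * exp (1 - (s + 1))); split.
  { apply Rmult_lt_0_compat; [apply Rpower_pos | apply exp_pos]. }
  intros t Ht; rewrite Rpower_Ropp.
  pose proof (Rpower_pos (1 + t) (s + 1)) as HP.
  apply Rmult_le_reg_r with (1 := HP).
  rewrite Rmult_assoc, Rinv_l, Rmult_1_r by lra.
  replace (Rpower (s + 1) (s + 1) * exp (1 - (s + 1)))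
    with (exp (- t) * (Rpower (s + 1) (s + 1) * exp (1 + t - (s + 1)))).
  - apply Rmult_le_compat_l; [left; apply exp_pos | apply Rpower_le_exp; lra].
  - replace (1 - (s + 1)) with (- t + (1 + t - (s + 1))) by ring.
    rewrite exp_plus; ring.
Qed.

Lemma filterlim_inv_1_plus : filterlim (fun t => / (1 + t)) (Rbar_locally p_infty) (locally 0).
Proof.
  apply filterlim_locally; intros [e He].
  exists (/ e); intros t Ht; simpl; change (Rabs (/ (1 + t) - 0) < e).
  assert (0 < / e) by (apply Rinv_0_lt_compat, He).
  rewrite Rminus_0_r, Rabs_pos_eq by (left; apply Rinv_0_lt_compat; lra).
  rewrite <- (Rinv_inv e); apply Rinv_lt_contravar; [apply Rmult_lt_0_compat; lra | lra].
Qed.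

(* The majorant [t^(s-1) (1+t)^(-s-1)] has the elementary primitive [(t/(1+t))^s / s]. *)
Lemma is_RInt_gen_Gamma s : 0 < s ->
  is_RInt_gen (Gamma_integrand s) (at_right 0) (Rbar_locally p_infty) (Gamma s).
Proof.
  intros Hs; apply (RInt_gen_correct (V := R_CompleteNormedModule)).
  destruct (Gamma_tail_bound s Hs) as [C [HC0 HC]].
  (* The quotient $t/(1+t)$ is written $1-1/(1+t)$, which shows its limit at infinity. *)
  apply (ex_RInt_gen_dominated (fun x => 0 < x) _ _ (Gamma_integrand s)
    (fun t => C / s * Rpower (1 + - / (1 + t)) s)
    (fun t => C * (Rpower t (s - 1) * Rpower (1 + t) (- (s + 1))))
    (C / s * 0) (C / s * Rpower (1 + - 0) s) improper_ends_0_infty).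
  - intros; apply continuous_Gamma_integrand; auto.
  - intros t Ht.
    assert (Hp : 0 < 1 + - / (1 + t)).
    { replace (1 + - / (1 + t)) with (t / (1 + t)) by (field; lra).
      apply Rdiv_lt_0_compat; lra. }
    assert (E : Rpower t (s - 1) = Rpower (1 + - / (1 + t)) s * Rpower (1 + t) s / t).
    { rewrite Rpower_minus_1, Rpower_mult_distr by lra.
      replace ((1 + - / (1 + t)) * (1 + t)) with t by (field; lra); reflexivity. }
    rewrite E, Rpower_Ropp, Rpower_plus, Rpower_1 by lra.
    assert (HQ := Rpower_pos (1 + t) s).
    set (Q := Rpower (1 + t) s) in *; unfold Rpower; auto_derive.
    + repeat split; auto; lra.
    + set (X := exp (s * _)); field; repeat split; try lra.
  - intros t Ht; apply (continuous_mult (K := R_AbsRing)); [apply continuous_const | ].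
    apply (continuous_mult (K := R_AbsRing)); [apply continuous_Rpower, Ht | ].
    apply (continuous_comp (fun t => 1 + t) (fun y => Rpower y (- (s + 1)))).
    + apply (continuous_plus (V := R_NormedModule)); [apply continuous_const | apply continuous_id].
    + apply continuous_Rpower; lra.
  - intros t Ht; rewrite Rabs_pos_eq by (left; apply Gamma_integrand_pos).
    unfold Gamma_integrand; specialize (HC t Ht); pose proof (Rpower_pos t (s - 1)); nra.
  - apply filterlim_Rmult; [apply _ | apply filterlim_const | ].
    apply (filterlim_comp _ _ _ (fun t => 1 + - / (1 + t)) (fun y => Rpower y s) _ (at_right 0)).
    2: apply filterlim_Rpower_at_right_0, Hs.
    intros P [e He]; exists e; intros t Ht H0; apply He.
    + change (Rabs (t - 0) < e) in Ht; change (Rabs (1 + - / (1 + t) - 0) < e).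
      rewrite Rminus_0_r in *; rewrite Rabs_pos_eq in Ht by lra.
      replace (1 + - / (1 + t)) with (t / (1 + t)) by (field; lra).
      rewrite Rabs_pos_eq by (left; apply Rdiv_lt_0_compat; lra).
      apply Rle_lt_trans with (2 := Ht); apply Rle_div_l; nra.
    + replace (1 + - / (1 + t)) with (t / (1 + t)) by (field; lra).
      apply Rdiv_lt_0_compat; lra.
  - apply filterlim_Rmult; [apply _ | apply filterlim_const | ].
    apply (filterlim_comp _ _ _ (fun t => 1 + - / (1 + t)) (fun y => Rpower y s) _ (locally (1 + - 0))).
    + apply filterlim_Rplus; [apply _ | apply filterlim_const | ].
      apply (filterlim_comp _ _ _ _ Ropp _ (locally 0) _ filterlim_inv_1_plus).
      apply (filterlim_opp (V := R_NormedModule)).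
    + apply continuous_Rpower; lra.
Qed.

(** Integration by parts: $t^s e^{-t}$ is a primitive of the difference of the two integrands and
    vanishes at both ends. *)
Lemma Gamma_succ s : 0 < s -> Gamma (s + 1) = s * Gamma s.
Proof.
  intros Hs.
  assert (H : is_RInt_gen (fun t => s * Gamma_integrand s t - Gamma_integrand (s + 1) t)
                (at_right 0) (Rbar_locally p_infty) (0 - 0)).
  { apply (is_RInt_gen_antiderivative (fun x => 0 < x) _ _ (fun t => Rpower t s * exp (- t)));
      [exact improper_ends_0_infty | | | | ].
    - intros t Ht; unfold Gamma_integrand.
      rewrite Rpower_minus_1 by exact Ht; replace (s + 1 - 1) with s by ring.
      unfold Rpower; auto_derive; [lra | field; lra].
    - intros t Ht; apply (continuous_minus (V := R_NormedModule)).
      + apply (continuous_mult (K := R_AbsRing)); [apply continuous_const | ].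
        apply continuous_Gamma_integrand, Ht.
      + apply continuous_Gamma_integrand, Ht.
    - replace 0 with (0 * exp (- 0)) at 2 by ring; apply filterlim_Rmult; [apply _ | | ].
      + apply filterlim_Rpower_at_right_0, Hs.
      + apply (filterlim_within_continuous _ (fun t => exp (- t))).
        apply continuous_exp_comp, (continuous_opp (V := R_NormedModule)), continuous_id.
    (* At infinity, $t^s e^{-t}\le(1+t)^s e^{-t}\le C/(1+t)$. *)
    - destruct (Gamma_tail_bound s Hs) as [C [HC0 HC]].
      apply (filterlim_le_le (F := Rbar_locally p_infty) (fun _ => 0)
               (fun t => Rpower t s * exp (- t)) (fun t => C * / (1 + t)) 0).
      + exists 1; intros t Ht; split.
        * left; apply Rmult_lt_0_compat; apply exp_pos.
        * specialize (HC t ltac:(lra)); rewrite Rpower_Ropp, Rpower_plus, Rpower_1 in HC by lra.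
          pose proof (Rpower_pos (1 + t) s) as HQ; pose proof (Rpower_pos t s).
          apply Rle_trans with (Rpower (1 + t) s * exp (- t)).
          -- apply Rmult_le_compat_r; [left; apply exp_pos | apply Rle_Rpower_l; lra].
          -- apply Rmult_le_compat_l with (r := Rpower (1 + t) s) in HC; [ | lra].
             apply Rle_trans with (1 := HC); right; field; lra.
      + apply filterlim_const.
      + simpl; replace 0 with (C * 0) by ring.
        apply filterlim_Rmult; [apply _ | apply filterlim_const | exact filterlim_inv_1_plus]. }
  assert (H2 : is_RInt_gen (fun t => s * Gamma_integrand s t - Gamma_integrand (s + 1) t)
                (at_right 0) (Rbar_locally p_infty) (s * Gamma s - Gamma (s + 1))).
  { apply (is_RInt_gen_minus (V := R_NormedModule) (fun t => s * Gamma_integrand s t)).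
    - apply (is_RInt_gen_scal (V := R_NormedModule)), is_RInt_gen_Gamma, Hs.
    - apply is_RInt_gen_Gamma; lra. }
  apply (is_RInt_gen_unique (V := R_CompleteNormedModule)) in H.
  apply (is_RInt_gen_unique (V := R_CompleteNormedModule)) in H2.
  lra.
Qed.

Lemma Gamma_1 : Gamma 1 = 1.
Proof.
  assert (H : is_RInt_gen (Gamma_integrand 1) (at_right 0) (Rbar_locally p_infty) (0 - - 1)).
  { apply (is_RInt_gen_antiderivative (fun x => 0 < x) _ _ (fun t => - exp (- t)));
      [exact improper_ends_0_infty | | | | ].
    - intros t Ht; unfold Gamma_integrand; rewrite Rminus_diag, Rpower_O by exact Ht.
      auto_derive; [trivial | ring].
    - intros; apply continuous_Gamma_integrand; assumption.
    - replace (- 1) with (- exp (- 0)) by (rewrite Ropp_0, exp_0; reflexivity).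
      apply (filterlim_within_continuous _ (fun t => - exp (- t))).
      apply (ex_derive_continuous (V := R_NormedModule)); auto_derive; trivial.
    - apply (filterlim_comp _ _ _ (fun t => - t) (fun y => - exp y) _ (Rbar_locally m_infty)).
      + apply (filterlim_Rbar_opp p_infty).
      + replace 0 with (- 0) by ring.
        apply (filterlim_comp _ _ _ exp Ropp _ (locally 0)).
        * exact is_lim_exp_m.
        * apply (filterlim_opp (V := R_NormedModule)). }
  apply (is_RInt_gen_unique (V := R_CompleteNormedModule)) in H.
  unfold Gamma, Gamma_integrand in *; rewrite H; ring.
Qed.

(** In place of Hölder's inequality, [Rpower_Bernoulli] at $z=t/s$ bounds $t^\theta$ by
    $s^\theta(1-\theta+\theta t/s)$ under the integral. Since $\Gamma(s+1)/s=\Gamma(s)$, the two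
    resulting terms add up to $s^\theta\Gamma(s)$. *)
Lemma Gamma_Wendel s th : 0 < s -> 0 <= th <= 1 -> Gamma (s + th) <= Rpower s th * Gamma s.
Proof.
  intros Hs Hth.
  replace (Rpower s th * Gamma s)
    with (Rpower s th * (1 - th) * Gamma s + Rpower s th * th / s * Gamma (s + 1))
    by (rewrite Gamma_succ by exact Hs; field; lra).
  apply (is_RInt_gen_le_ends (fun x => 0 < x) _ _ (Gamma_integrand (s + th))
    (fun t => Rpower s th * (1 - th) * Gamma_integrand s t
              + Rpower s th * th / s * Gamma_integrand (s + 1) t) _ _ improper_ends_0_infty).
  - intros t Ht; unfold Gamma_integrand.
    replace (s + th - 1) with ((s - 1) + th) by ring.
    replace (s + 1 - 1) with ((s - 1) + 1) by ring.
    rewrite 2!Rpower_plus, Rpower_1 by exact Ht.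
    replace (Rpower t th) with (Rpower s th * Rpower (t / s) th).
    2:{ rewrite Rpower_mult_distr by (try apply Rdiv_lt_0_compat; lra); f_equal; field; lra. }
    assert (H := Rpower_Bernoulli (t / s) th ltac:(apply Rdiv_lt_0_compat; lra) Hth).
    assert (HP : 0 < Rpower s th * (Rpower t (s - 1) * exp (- t)))
      by (repeat apply Rmult_lt_0_compat; apply exp_pos).
    apply Rmult_le_compat_l with (r := Rpower s th * (Rpower t (s - 1) * exp (- t))) in H; [ | lra].
    eapply Rle_trans; [ | eapply Rle_trans; [exact H | ]]; right; [ring | field; lra].
  - apply is_RInt_gen_Gamma; lra.
  - apply (is_RInt_gen_plus (V := R_NormedModule));
      apply (is_RInt_gen_scal (V := R_NormedModule)); apply is_RInt_gen_Gamma; lra.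
Qed.

(** On $(0,1]$, the Wendel bound with $\theta=1-s$ reads $1=\Gamma(1)\le s^{1-s}\Gamma(s)$; the
    functional equation carries positivity upwards. *)
Lemma Gamma_pos s : 0 < s -> 0 < Gamma s.
Proof.
  assert (H01 : forall s, 0 < s <= 1 -> 0 < Gamma s).
  { intros t Ht; pose proof (Gamma_Wendel t (1 - t) ltac:(lra) ltac:(lra)) as H.
    replace (t + (1 - t)) with 1 in H by ring; rewrite Gamma_1 in H.
    pose proof (Rpower_pos t (1 - t)); nra. }
  assert (Hn : forall n s, 0 < s <= INR n + 1 -> 0 < Gamma s).
  { induction n as [ | n IH]; intros t Ht.
    - simpl in Ht; apply H01; lra.
    - rewrite S_INR in Ht; destruct (Rle_dec t 1); [apply H01; lra | ].
      replace t with ((t - 1) + 1) by ring; rewrite Gamma_succ by lra.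
      apply Rmult_lt_0_compat; [lra | apply IH; lra]. }
  intros Hs; destruct (INR_unbounded s) as [n Hnn]; apply (Hn n); lra.
Qed.

Lemma Gamma_lower s th : 0 < s -> 0 <= th <= 1 ->
  s * Gamma s <= Rpower (s + th) (1 - th) * Gamma (s + th).
Proof.
  intros Hs Hth; rewrite <- Gamma_succ by exact Hs.
  replace (s + 1) with ((s + th) + (1 - th)) by ring; apply Gamma_Wendel; lra.
Qed.

(** The lower bound at [p] times the upper bound at [q]. The prefactors have exponents $1-\theta$
    and $\theta$, so a common bound [M] on their bases bounds their product. *)
Lemma Gamma_cross p q th M : 0 < p -> 0 < q -> 0 <= th <= 1 -> p + th <= M -> q <= M ->
  p * Gamma p * Gamma (q + th) <= M * (Gamma (p + th) * Gamma q).
Proof.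
  intros Hp Hq Hth HpM HqM.
  pose proof (Gamma_lower p th Hp Hth) as H1; pose proof (Gamma_Wendel q th Hq Hth) as H2.
  pose proof (Gamma_pos p Hp); pose proof (Gamma_pos q Hq).
  pose proof (Gamma_pos (p + th) ltac:(lra)); pose proof (Gamma_pos (q + th) ltac:(lra)).
  assert (HM : Rpower (p + th) (1 - th) * Rpower q th <= M).
  { replace M with (Rpower M (1 - th) * Rpower M th).
    - apply Rmult_le_compat; try (left; apply Rpower_pos); apply Rle_Rpower_l; lra.
    - rewrite <- Rpower_plus; replace (1 - th + th) with 1 by ring; apply Rpower_1; lra. }
  apply Rle_trans with
    ((Rpower (p + th) (1 - th) * Gamma (p + th)) * (Rpower q th * Gamma q)).
  - apply Rmult_le_compat; try assumption; try nra.
  - replace (Rpower (p + th) (1 - th) * Gamma (p + th) * (Rpower q th * Gamma q))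
      with (Rpower (p + th) (1 - th) * Rpower q th * (Gamma (p + th) * Gamma q)) by ring.
    apply Rmult_le_compat_r; [nra | exact HM].
Qed.

(** * The Beta integral characterized by recurrence and monotonicity *)

(** This is $w^{2(g+b-1)}B(g,b)$, the expected value of $\int_0^w 2(w^2-u^2)^{g-1}u^{2b-1}\,du$
    after substituting $u^2=w^2v$. *)
Definition EK_moment (w g b : R) : R :=
  Rpower w (2 * (g + b - 1)) * (Gamma g * Gamma b / Gamma (g + b)).

Lemma EK_moment_pos w g b : 0 < g -> 0 < b -> 0 < EK_moment w g b.
Proof.
  intros Hg Hb; apply Rmult_lt_0_compat; [apply Rpower_pos | ].
  apply Rdiv_lt_0_compat; [apply Rmult_lt_0_compat | ]; apply Gamma_pos; lra.
Qed.

Lemma EK_moment_succ w g b : 0 < w -> 0 < g -> 0 < b ->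
  b * w ^ 2 * EK_moment w g b = (g + b) * EK_moment w g (b + 1).
Proof.
  intros Hw Hg Hb; unfold EK_moment.
  replace (2 * (g + (b + 1) - 1)) with (2 * (g + b - 1) + 2) by ring.
  replace (g + (b + 1)) with (g + b + 1) by ring.
  rewrite Rpower_plus, Rpower_2, 2!Gamma_succ by lra.
  pose proof (Gamma_pos (g + b) ltac:(lra)); field; lra.
Qed.

Lemma EK_moment_1 w g : 0 < g -> EK_moment w g 1 = Rpower w (2 * g) / g.
Proof.
  intros Hg; unfold EK_moment; replace (g + 1 - 1) with g by ring.
  rewrite Gamma_succ, Gamma_1 by exact Hg; pose proof (Gamma_pos g Hg); field; lra.
Qed.

(** With [EK_moment_upper] this places $V(p+s)/(w^{2s}V(p))$, where $V$ is [EK_moment w g], between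
    $p/(g+p+s)$ and $(g+p+s)/(g+p)$, which both tend to 1 as $p$ grows. The two bounds are
    [Gamma_cross] for [p] and [g + p], in either order. *)
Lemma EK_moment_lower w g p s : 0 < g -> 0 < p -> 0 <= s <= 1 ->
  p * Rpower w (2 * s) * EK_moment w g p <= (g + p + s) * EK_moment w g (p + s).
Proof.
  intros Hg Hp Hs.
  pose proof (Gamma_cross p (g + p) s (g + p + s) Hp ltac:(lra) Hs ltac:(lra) ltac:(lra)) as H.
  unfold EK_moment; replace (2 * (g + (p + s) - 1)) with (2 * (g + p - 1) + 2 * s) by ring.
  replace (g + (p + s)) with (g + p + s) by ring; rewrite Rpower_plus.
  pose proof (Gamma_pos (g + p) ltac:(lra)); pose proof (Gamma_pos (g + p + s) ltac:(lra)).
  set (K := Rpower w (2 * (g + p - 1)) * Rpower w (2 * s) * Gamma g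
            / (Gamma (g + p) * Gamma (g + p + s))).
  assert (HK : 0 < K).
  { apply Rdiv_lt_0_compat; repeat apply Rmult_lt_0_compat;
      try apply Rpower_pos; try apply Gamma_pos; lra. }
  apply Rmult_le_compat_l with (r := K) in H; [ | lra].
  eapply Rle_trans; [ | eapply Rle_trans; [exact H | ]]; right; unfold K; field; lra.
Qed.

Lemma EK_moment_upper w g p s : 0 < g -> 0 < p -> 0 <= s <= 1 ->
  (g + p) * EK_moment w g (p + s) <= (g + p + s) * (Rpower w (2 * s) * EK_moment w g p).
Proof.
  intros Hg Hp Hs.
  pose proof (Gamma_cross (g + p) p s (g + p + s) ltac:(lra) Hp Hs ltac:(lra) ltac:(lra)) as H.
  unfold EK_moment; replace (2 * (g + (p + s) - 1)) with (2 * (g + p - 1) + 2 * s) by ring.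
  replace (g + (p + s)) with (g + p + s) by ring; rewrite Rpower_plus.
  pose proof (Gamma_pos (g + p) ltac:(lra)); pose proof (Gamma_pos (g + p + s) ltac:(lra)).
  set (K := Rpower w (2 * (g + p - 1)) * Rpower w (2 * s) * Gamma g
            / (Gamma (g + p) * Gamma (g + p + s))).
  assert (HK : 0 < K).
  { apply Rdiv_lt_0_compat; repeat apply Rmult_lt_0_compat;
      try apply Rpower_pos; try apply Gamma_pos; lra. }
  apply Rmult_le_compat_l with (r := K) in H; [ | lra].
  eapply Rle_trans; [ | eapply Rle_trans; [exact H | ]]; right; unfold K; field; lra.
Qed.

(* In the spirit of Bohr-Mollerup: the ratio [J / EK_moment] has period 1, equals 1 at the
   integers, and the monotonicity of [J] squeezes it to 1 as its argument tends to infinity. *)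
Lemma EK_moment_unique w g (J : R -> R) : 0 < w -> 0 < g ->
  (forall b, 0 < b -> b * w ^ 2 * J b = (g + b) * J (b + 1)) ->
  J 1 = Rpower w (2 * g) / g ->
  (forall b s, 0 < b -> 0 <= s -> J (b + s) <= Rpower w (2 * s) * J b) ->
  forall b, 0 < b -> J b = EK_moment w g b.
Proof.
  intros Hw Hg Hrec H1 Hmon.
  set (V := EK_moment w g).
  assert (Vrec : forall b, 0 < b -> b * w ^ 2 * V b = (g + b) * V (b + 1))
    by (intros; apply EK_moment_succ; assumption).
  assert (Vpos : forall b, 0 < b -> 0 < V b) by (intros; apply EK_moment_pos; assumption).
  assert (Hw2 : 0 < w ^ 2) by (apply pow_lt, Hw).
  assert (Hstep : forall b r, 0 < b -> J b = r * V b -> J (b + 1) = r * V (b + 1)).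
  { intros b r Hb E; apply Rmult_eq_reg_l with (g + b); [ | lra].
    rewrite <- Hrec, E by exact Hb.
    replace (b * w ^ 2 * (r * V b)) with (r * (b * w ^ 2 * V b)) by ring.
    rewrite Vrec by exact Hb; ring. }
  assert (Hint : forall n, J (1 + INR n) = V (1 + INR n)).
  { induction n as [ | n IH].
    - rewrite Rplus_0_r, H1; symmetry; apply EK_moment_1, Hg.
    - rewrite S_INR, <- Rplus_assoc; pose proof (pos_INR n).
      rewrite (Hstep _ 1) by lra; ring. }
  assert (H01 : forall s, 0 < s <= 1 -> J s = V s).
  { intros s Hs.
    set (r := J s / V s).
    pose proof (Vpos s ltac:(lra)) as HVs.
    assert (Hr : forall n, J (s + INR n) = r * V (s + INR n)).
    { induction n as [ | n IH].
      - simpl INR; rewrite Rplus_0_r; unfold r; field; lra.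
      - rewrite S_INR, <- Rplus_assoc; pose proof (pos_INR n); apply Hstep; [lra | exact IH]. }
    (* Put $p=n+1$, where [J] and [V] agree. Monotonicity from $p$ to $p+s$ bounds [r] above; from
       $p+s$ to $p+1$, where the recurrence gives [J], it bounds [r] below. *)
    assert (Hbounds : forall n, (1 + INR n) * r <= g + (1 + INR n) + s
                               /\ 1 + INR n <= (g + (1 + INR n) + s) * r).
    { intros n; pose proof (pos_INR n); specialize (Hr (S n)).
      set (p := 1 + INR n) in *; assert (Hp : 0 < p) by (unfold p; lra).
      replace (s + INR (S n)) with (p + s) in Hr by (rewrite S_INR; unfold p; ring).
      assert (HJp : J p = V p) by (apply Hint).
      pose proof (Vpos (p + s) ltac:(lra)) as HV.
      split.
      - apply Rmult_le_reg_r with (1 := HV).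
        replace (p * r * V (p + s)) with (p * J (p + s)) by (rewrite Hr; ring).
        apply Rle_trans with (2 := EK_moment_lower w g p s Hg Hp ltac:(lra)).
        rewrite Rmult_assoc; apply Rmult_le_compat_l; [lra | ].
        fold (V p); rewrite <- HJp; apply Hmon; lra.
      - pose proof (EK_moment_upper w g p s Hg Hp ltac:(lra)) as HU.
        pose proof (Hmon (p + s) (1 - s) ltac:(lra) ltac:(lra)) as HM.
        replace (p + s + (1 - s)) with (p + 1) in HM by ring.
        assert (HC : 0 < (g + p) * w ^ 2 * V (p + s))
          by (apply Rmult_lt_0_compat; [apply Rmult_lt_0_compat | ]; lra).
        apply Rmult_le_reg_r with (1 := HC).
        apply Rle_trans with ((g + p + s) * Rpower w (2 * s) * (p * w ^ 2 * V p)).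
        + apply Rmult_le_compat_l with (r := p * w ^ 2) in HU; [ | nra].
          eapply Rle_trans; [ | eapply Rle_trans; [exact HU | ]]; right; unfold V; ring.
        + rewrite <- HJp, Hrec by exact Hp.
          assert (HQ : 0 < (g + p + s) * Rpower w (2 * s) * (g + p))
            by (repeat apply Rmult_lt_0_compat; try apply Rpower_pos; lra).
          apply Rmult_le_compat_l with (r := (g + p + s) * Rpower w (2 * s) * (g + p)) in HM; [ | lra].
          eapply Rle_trans; [ | eapply Rle_trans; [exact HM | ]]; right; [ring | ].
          replace (w ^ 2) with (Rpower w (2 * s) * Rpower w (2 * (1 - s))).
          * rewrite Hr; ring.
          * rewrite <- Rpower_plus, <- (Rpower_2 w Hw); f_equal; ring. }
    assert (r = 1).
    { destruct (Rtotal_order r 1) as [Hlt | [ -> | Hgt]]; [ | reflexivity | ]; exfalso.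
      - destruct (INR_unbounded ((g + s) * r / (1 - r))) as [n Hn].
        apply Rmult_gt_compat_r with (r := 1 - r) in Hn; [ | lra].
        unfold Rdiv in Hn; rewrite Rmult_assoc, Rinv_l, Rmult_1_r in Hn by lra.
        destruct (Hbounds n) as [_ Hb]; pose proof (pos_INR n); nra.
      - destruct (INR_unbounded ((g + s) / (r - 1))) as [n Hn].
        apply Rmult_gt_compat_r with (r := r - 1) in Hn; [ | lra].
        unfold Rdiv in Hn; rewrite Rmult_assoc, Rinv_l, Rmult_1_r in Hn by lra.
        destruct (Hbounds n) as [Hb _]; pose proof (pos_INR n); nra. }
    unfold r in H; apply Rmult_eq_compat_r with (r := V s) in H.
    unfold Rdiv in H; rewrite Rmult_assoc, Rinv_l in H; lra. }
  assert (Hn : forall n b, 0 < b <= INR n + 1 -> J b = V b).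
  { induction n as [ | n IH]; intros b Hb.
    - simpl in Hb; apply H01; lra.
    - rewrite S_INR in Hb; destruct (Rle_dec b 1); [apply H01; lra | ].
      replace b with ((b - 1) + 1) by ring; rewrite (Hstep _ 1); [ring | lra | ].
      rewrite Rmult_1_l; apply IH; lra. }
  intros b Hb; destruct (INR_unbounded b) as [n Hnn]; apply (Hn n); lra.
Qed.

(** * Moments of the Erdélyi-Kober kernel *)

(** The integrand of [EK_pos 2 0 g] at the function $u^{2b-2}$, with the factor $u$ from $d(u^2)$
    merged into the power. *)
Definition EK_kernel (w g b u : R) : R :=
  2 * Rpower (w ^ 2 - u ^ 2) (g - 1) * Rpower u (2 * b - 1).

Lemma EK_kernel_pos w g b u : 0 < EK_kernel w g b u.
Proof. repeat apply Rmult_lt_0_compat; try apply Rpower_pos; lra. Qed.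

Lemma sqr_diff_pos u w : 0 < u < w -> 0 < w ^ 2 - u ^ 2.
Proof. intros; nra. Qed.

Lemma is_derive_Rpower_sqr_diff w g u : 0 < u < w ->
  is_derive (fun u => Rpower (w ^ 2 - u ^ 2) g) u
            (- (2 * g * u * Rpower (w ^ 2 - u ^ 2) (g - 1))).
Proof.
  intros Hu; pose proof (sqr_diff_pos u w Hu) as HX.
  replace (- (2 * g * u * Rpower (w ^ 2 - u ^ 2) (g - 1)))
    with (- (2 * u) * (g * Rpower (w ^ 2 - u ^ 2) (g - 1))) by ring.
  apply (is_derive_comp (K := R_AbsRing) (V := R_NormedModule)
           (fun x => Rpower x g) (fun u => w ^ 2 - u ^ 2)).
  - apply is_derive_Rpower, HX.
  - auto_derive; [trivial | ring].
Qed.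

Lemma continuous_EK_kernel w g b u : 0 < u < w -> continuous (EK_kernel w g b) u.
Proof.
  intros Hu; apply (continuous_mult (K := R_AbsRing)).
  - apply (continuous_mult (K := R_AbsRing)); [apply continuous_const | ].
    apply (ex_derive_continuous (V := R_NormedModule)).
    eexists; apply is_derive_Rpower_sqr_diff, Hu.
  - apply continuous_Rpower; lra.
Qed.

Lemma filterlim_Rpower_sqr_diff_left w g : 0 < w -> 0 < g ->
  filterlim (fun u => Rpower (w ^ 2 - u ^ 2) g) (at_left w) (locally 0).
Proof.
  intros Hw Hg.
  apply (filterlim_comp _ _ _ (fun u => w ^ 2 - u ^ 2) (fun x => Rpower x g) _ (at_right 0)).
  2: apply filterlim_Rpower_at_right_0, Hg.
  assert (Hc : filterlim (fun u => w ^ 2 - u ^ 2) (locally w) (locally 0)).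
  { replace 0 with (w ^ 2 - w ^ 2) by ring.
    apply (ex_derive_continuous (V := R_NormedModule) (fun u => w ^ 2 - u ^ 2)); auto_derive; trivial. }
  intros P HP; specialize (Hc _ HP); unfold filtermap, at_left, within in *.
  assert (HD : locally w (fun u => 0 < u)) by (apply (open_gt 0 w Hw)).
  generalize (filter_and _ _ Hc HD); apply filter_imp.
  intros u [H1 H2] H3; apply H1, sqr_diff_pos; lra.
Qed.

Lemma filterlim_Rpower_sqr_diff_right w g : 0 < w ->
  filterlim (fun u => Rpower (w ^ 2 - u ^ 2) g) (at_right 0) (locally (Rpower w (2 * g))).
Proof.
  intros Hw; replace (Rpower w (2 * g)) with (Rpower (w ^ 2 - 0 ^ 2) g).
  - apply (filterlim_within_continuous _ (fun u => Rpower (w ^ 2 - u ^ 2) g)).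
    apply (continuous_comp (fun u => w ^ 2 - u ^ 2) (fun x => Rpower x g)).
    + apply (ex_derive_continuous (V := R_NormedModule)); auto_derive; trivial.
    + apply continuous_Rpower; pose proof (pow_lt w 2 Hw); simpl in *; lra.
  - rewrite <- Rpower_mult, Rpower_2 by exact Hw; f_equal; ring.
Qed.

Lemma filterlim_Rpower_left w b : 0 < w ->
  filterlim (fun u => Rpower u b) (at_left w) (locally (Rpower w b)).
Proof.
  intros Hw; apply (filterlim_within_continuous _ (fun u => Rpower u b)).
  apply continuous_Rpower, Hw.
Qed.

Lemma Rpower_eq_mult x a b : 0 < x -> a = b + 1 -> Rpower x a = Rpower x b * x.
Proof. intros Hx ->; rewrite Rpower_plus, Rpower_1 by exact Hx; reflexivity. Qed.

(* At every point one of [w^2 - u^2] and [u^2] is at least [w^2/2], so only one of the two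
   factors of the kernel can be unbounded there. *)
Lemma ex_RInt_gen_EK_kernel w g b : 0 < w -> 0 < g -> 0 < b ->
  ex_RInt_gen (EK_kernel w g b) (at_right 0) (at_left w).
Proof.
  intros Hw Hg Hb.
  (* By [Rpower_le_sum], [C e] bounds $z^e$ on $[w^2/2,w^2]$. Freezing the bounded factor of the
     kernel leaves a derivative of $u^{2b}$ or of $(w^2-u^2)^g$, up to a constant. *)
  set (C e := Rpower (w ^ 2 / 2) e + Rpower (w ^ 2) e).
  assert (HC : forall e, 0 < C e)
    by (intros e; pose proof (Rpower_pos (w ^ 2 / 2) e); pose proof (Rpower_pos (w ^ 2) e);
        unfold C; lra).
  pose proof (pow_lt w 2 Hw) as Hw2.
  apply (ex_RInt_gen_dominated (fun u => 0 < u < w) _ _ (EK_kernel w g b)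
    (fun u => C (g - 1) / b * Rpower u (2 * b)
              + - (C (b - 1) / g) * Rpower (w ^ 2 - u ^ 2) g)
    (fun u => C (g - 1) * (2 * Rpower u (2 * b - 1))
              + C (b - 1) * (2 * u * Rpower (w ^ 2 - u ^ 2) (g - 1)))
    (C (g - 1) / b * 0 + - (C (b - 1) / g) * Rpower w (2 * g))
    (C (g - 1) / b * Rpower w (2 * b) + - (C (b - 1) / g) * 0)
    (improper_ends_0_left w Hw)).
  - intros; apply continuous_EK_kernel; assumption.
  - intros u Hu.
    replace (C (g - 1) * (2 * Rpower u (2 * b - 1))
              + C (b - 1) * (2 * u * Rpower (w ^ 2 - u ^ 2) (g - 1)))
      with (C (g - 1) / b * (2 * b * Rpower u (2 * b - 1))
        + - (C (b - 1) / g) * - (2 * g * u * Rpower (w ^ 2 - u ^ 2) (g - 1)))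
      by (field; lra).
    apply (is_derive_plus (V := R_NormedModule));
      apply is_derive_scal.
    + apply is_derive_Rpower; lra.
    + apply is_derive_Rpower_sqr_diff, Hu.
  - intros u Hu.
    apply (continuous_plus (V := R_NormedModule)); apply (continuous_mult (K := R_AbsRing));
      try apply continuous_const; apply (continuous_mult (K := R_AbsRing)).
    + apply continuous_const.
    + apply continuous_Rpower; lra.
    + apply (continuous_mult (K := R_AbsRing)); [apply continuous_const | apply continuous_id].
    + apply (ex_derive_continuous (V := R_NormedModule)).
      eexists; apply is_derive_Rpower_sqr_diff, Hu.
  - intros u Hu; rewrite Rabs_pos_eq by (left; apply EK_kernel_pos).
    pose proof (sqr_diff_pos u w Hu) as HX; pose proof (pow_lt u 2 (proj1 Hu)) as HY.
    pose proof (HC (g - 1)); pose proof (HC (b - 1)).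
    assert (E : Rpower u (2 * b - 1) = Rpower (u ^ 2) (b - 1) * u).
    { rewrite <- (Rpower_2 u), Rpower_mult by lra; apply Rpower_eq_mult; lra. }
    unfold EK_kernel.
    pose proof (Rpower_pos u (2 * b - 1)); pose proof (Rpower_pos (w ^ 2 - u ^ 2) (g - 1)).
    destruct (Rle_dec (u ^ 2) (w ^ 2 / 2)).
    + assert (Rpower (w ^ 2 - u ^ 2) (g - 1) <= C (g - 1)) by (apply Rpower_le_sum; lra).
      assert (0 <= C (b - 1) * (2 * u * Rpower (w ^ 2 - u ^ 2) (g - 1)))
        by (repeat apply Rmult_le_pos; lra).
      nra.
    + assert (Rpower (u ^ 2) (b - 1) <= C (b - 1)) by (apply Rpower_le_sum; lra).
      assert (0 <= C (g - 1) * (2 * Rpower u (2 * b - 1)))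
        by (repeat apply Rmult_le_pos; lra).
      assert (0 < 2 * u * Rpower (w ^ 2 - u ^ 2) (g - 1))
        by (repeat apply Rmult_lt_0_compat; lra).
      rewrite E in *; nra.
  - apply filterlim_Rplus; [apply _ | | ];
      (apply filterlim_Rmult; [apply _ | apply filterlim_const | ]).
    + apply filterlim_Rpower_at_right_0; lra.
    + apply filterlim_Rpower_sqr_diff_right, Hw.
  - apply filterlim_Rplus; [apply _ | | ];
      (apply filterlim_Rmult; [apply _ | apply filterlim_const | ]).
    + apply filterlim_Rpower_left, Hw.
    + apply filterlim_Rpower_sqr_diff_left; assumption.
Qed.

(** The recurrence comes from $u^{2c}(w^2-u^2)^g$, which vanishes at both ends; the value at 1 from
    the primitive $-(w^2-u^2)^g/g$; the monotonicity from $u^{2s}\le w^{2s}$. *)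
Lemma is_RInt_gen_EK_kernel w g b : 0 < w -> 0 < g -> 0 < b ->
  is_RInt_gen (EK_kernel w g b) (at_right 0) (at_left w) (EK_moment w g b).
Proof.
  intros Hw Hg.
  set (J b := RInt_gen (EK_kernel w g b) (at_right 0) (at_left w)).
  assert (HJ : forall b, 0 < b -> is_RInt_gen (EK_kernel w g b) (at_right 0) (at_left w) (J b)).
  { intros c Hc; apply (RInt_gen_correct (V := R_CompleteNormedModule)).
    apply ex_RInt_gen_EK_kernel; assumption. }
  enough (HV : forall b, 0 < b -> J b = EK_moment w g b)
    by (intros Hb; rewrite <- HV by exact Hb; apply HJ, Hb).
  pose proof (improper_ends_0_left w Hw) as HD.
  apply EK_moment_unique; [exact Hw | exact Hg | | | ].
  - intros c Hc.
    assert (H : is_RInt_gen (fun u => c * w ^ 2 * EK_kernel w g c u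
                  - (g + c) * EK_kernel w g (c + 1) u) (at_right 0) (at_left w)
                (Rpower w (2 * c) * 0 - 0 * Rpower w (2 * g))).
    { apply (is_RInt_gen_antiderivative (fun u => 0 < u < w) _ _
               (fun u => Rpower u (2 * c) * Rpower (w ^ 2 - u ^ 2) g)); [exact HD | | | | ].
      - intros u Hu; pose proof (sqr_diff_pos u w Hu) as HX.
        replace (c * w ^ 2 * EK_kernel w g c u - (g + c) * EK_kernel w g (c + 1) u)
          with (2 * c * Rpower u (2 * c - 1) * Rpower (w ^ 2 - u ^ 2) g
            + Rpower u (2 * c) * - (2 * g * u * Rpower (w ^ 2 - u ^ 2) (g - 1))).
        + apply (is_derive_mult (fun u => Rpower u (2 * c)) (fun u => Rpower (w ^ 2 - u ^ 2) g));
            [apply is_derive_Rpower; lra | apply is_derive_Rpower_sqr_diff, Hu | ].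
          intros; apply Rmult_comm.
        (* Splitting one factor $w^2-u^2$ off $(w^2-u^2)^g$ leaves
           $2c(w^2-u^2)-2gu^2=2cw^2-2(g+c)u^2$, the coefficients of the recurrence. *)
        + unfold EK_kernel.
          rewrite (Rpower_eq_mult u (2 * (c + 1) - 1) (2 * c)),
            (Rpower_eq_mult u (2 * c) (2 * c - 1)), 
            (Rpower_eq_mult (w ^ 2 - u ^ 2) g (g - 1)) by lra; ring.
      - intros u Hu; apply (continuous_minus (V := R_NormedModule));
          (apply (continuous_mult (K := R_AbsRing)); [apply continuous_const | ]);
          apply continuous_EK_kernel, Hu.
      - apply filterlim_Rmult; [apply _ | | ].
        + apply filterlim_Rpower_at_right_0; lra.
        + apply filterlim_Rpower_sqr_diff_right, Hw.
      - apply filterlim_Rmult; [apply _ | | ].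
        + apply filterlim_Rpower_left, Hw.
        + apply filterlim_Rpower_sqr_diff_left; assumption. }
    assert (H2 : is_RInt_gen (fun u => c * w ^ 2 * EK_kernel w g c u
                  - (g + c) * EK_kernel w g (c + 1) u) (at_right 0) (at_left w)
                (c * w ^ 2 * J c - (g + c) * J (c + 1))).
    { apply (is_RInt_gen_minus (V := R_NormedModule) (fun u => c * w ^ 2 * EK_kernel w g c u));
        apply (is_RInt_gen_scal (V := R_NormedModule)); apply HJ; lra. }
    apply (is_RInt_gen_unique (V := R_CompleteNormedModule)) in H.
    apply (is_RInt_gen_unique (V := R_CompleteNormedModule)) in H2.
    lra.
  - replace (Rpower w (2 * g) / g) with (- / g * 0 - - / g * Rpower w (2 * g)) by (field; lra).
    unfold J; apply (is_RInt_gen_unique (V := R_CompleteNormedModule)).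
    apply (is_RInt_gen_antiderivative (fun u => 0 < u < w) _ _
             (fun u => - / g * Rpower (w ^ 2 - u ^ 2) g)); [exact HD | | | | ].
    + intros u Hu.
      replace (EK_kernel w g 1 u)
        with (- / g * - (2 * g * u * Rpower (w ^ 2 - u ^ 2) (g - 1))).
      * apply is_derive_scal, is_derive_Rpower_sqr_diff, Hu.
      * unfold EK_kernel; replace (2 * 1 - 1) with 1 by ring; rewrite Rpower_1 by lra; field; lra.
    + intros; apply continuous_EK_kernel; assumption.
    + apply filterlim_Rmult; [apply _ | apply filterlim_const | ].
      apply filterlim_Rpower_sqr_diff_right, Hw.
    + apply filterlim_Rmult; [apply _ | apply filterlim_const | ].
      apply filterlim_Rpower_sqr_diff_left; assumption.
  - intros c s Hc Hs.
    apply (is_RInt_gen_le_ends (fun u => 0 < u < w) _ _ (EK_kernel w g (c + s))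
      (fun u => Rpower w (2 * s) * EK_kernel w g c u) _ _ HD).
    + intros u Hu; unfold EK_kernel.
      replace (2 * (c + s) - 1) with (2 * c - 1 + 2 * s) by ring; rewrite Rpower_plus.
      pose proof (Rle_Rpower_l u w (2 * s) ltac:(lra) ltac:(lra)).
      pose proof (Rpower_pos u (2 * c - 1)); pose proof (Rpower_pos (w ^ 2 - u ^ 2) (g - 1)).
      assert (0 < 2 * Rpower (w ^ 2 - u ^ 2) (g - 1) * Rpower u (2 * c - 1))
        by (repeat apply Rmult_lt_0_compat; lra).
      nra.
    + apply HJ; lra.
    + apply (is_RInt_gen_scal (V := R_NormedModule)), HJ, Hc.
Qed.

(** * Everywhere convergent coefficient sequences and fractional power series *)

(** Absolute convergence at every radius yields convergence of the series, differentiability of its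
    sum and the summable majorant needed under the integral. *)
Definition entire (b : nat -> R) : Prop := forall r, CV_disk b r.

Lemma entire_CV_radius b x : entire b -> Rbar_lt (Rabs x) (CV_radius b).
Proof.
  intros Hb; apply Rbar_lt_le_trans with (Rabs x + 1); [simpl; lra | ].
  exact (proj1 (Lub_Rbar_correct (CV_disk b)) _ (Hb _)).
Qed.

Lemma entire_ex_pseries b x : entire b -> ex_pseries b x.
Proof. intros Hb; apply CV_disk_correct, Hb. Qed.

Lemma INR_S_le_pow2 n : INR n + 1 <= 2 ^ n.
Proof.
  induction n as [ | n IH]; [simpl; lra | ].
  rewrite S_INR; simpl pow; pose proof (pos_INR n); lra.
Qed.

(** Doubling the radius pays for linear growth, because $n+1\le2^n$. *)
Lemma entire_mult_linear (m b : nat -> R) C : entire b ->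
  (forall n, Rabs (m n) <= C * (INR n + 1)) -> entire (fun n => m n * b n).
Proof.
  intros Hb Hm r; specialize (Hb (2 * r)); unfold CV_disk in *.
  apply (ex_series_le (K := R_AbsRing) (V := R_CompleteNormedModule) _
           (fun n => C * Rabs (b n * (2 * r) ^ n))).
  - intros n; change (Rabs (Rabs (m n * b n * r ^ n)) <= C * Rabs (b n * (2 * r) ^ n)).
    rewrite Rabs_Rabsolu, Rpow_mult_distr, !Rabs_mult, (Rabs_pos_eq (2 ^ n))
      by (apply pow_le; lra).
    specialize (Hm n); pose proof (INR_S_le_pow2 n); pose proof (pos_INR n).
    assert (0 <= C) by (pose proof (Rabs_pos (m n)); nra).
    assert (H2 : Rabs (m n) <= C * 2 ^ n) by nra.
    pose proof (Rmult_le_pos _ _ (Rabs_pos (b n)) (Rabs_pos (r ^ n))) as H3.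
    apply Rmult_le_compat_r with (1 := H3) in H2; lra.
  - apply (ex_series_scal (V := R_NormedModule) C (fun n => Rabs (b n * (2 * r) ^ n))), Hb.
Qed.

(* [w^(2 alpha - 2)] times a power series in [w^(2 alpha)]: the class of functions on which
   all the operators below act diagonally. *)
Definition frac_series (alpha : R) (b : nat -> R) (w : R) : R :=
  Rpower w (2 * alpha - 2) * PSeries b (Rpower w (2 * alpha)).

Lemma is_derive_frac_series alpha b w : entire b -> 0 < w ->
  is_derive (frac_series alpha b) w
    ((2 * alpha - 2) * Rpower w (2 * alpha - 2 - 1) * PSeries b (Rpower w (2 * alpha))
     + Rpower w (2 * alpha - 2) * ((2 * alpha * Rpower w (2 * alpha - 1))
         * PSeries (PS_derive b) (Rpower w (2 * alpha)))).
Proof.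
  intros Hb Hw.
  apply (is_derive_mult (fun w => Rpower w (2 * alpha - 2))
           (fun w => PSeries b (Rpower w (2 * alpha)))).
  - apply is_derive_Rpower, Hw.
  - apply (is_derive_comp (K := R_AbsRing) (V := R_NormedModule)
             (PSeries b) (fun w => Rpower w (2 * alpha))).
    + apply is_derive_PSeries, entire_CV_radius, Hb.
    + apply is_derive_Rpower, Hw.
  - intros; apply Rmult_comm.
Qed.

(** Each $w^{2\alpha k+2\alpha-2}$ is an eigenfunction of $x\,d/dx$. Agreement on $w>0$ is enough
    since the derivative is local, and it is all that is known of a function already produced by an
    operator. *)
Lemma xD_frac_series alpha b f w : entire b ->
  (forall x, 0 < x -> f x = frac_series alpha b x) -> 0 < w ->
  xD f w
  = frac_series alpha (fun k => 2 * (alpha * INR k + alpha - 1) * b k) w.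
Proof.
  intros Hb Hf Hw; unfold xD.
  rewrite (Derive_ext_loc f (frac_series alpha b)).
  2: apply (filter_imp (fun x => 0 < x)); [exact Hf | apply (open_gt 0 w Hw)].
  rewrite (is_derive_unique _ _ _ (is_derive_frac_series alpha b w Hb Hw)).
  unfold frac_series; rewrite !Rpower_minus_1 by exact Hw.
  set (y := Rpower w (2 * alpha)).
  assert (Hk : entire (fun k => INR k * b k)).
  { apply (entire_mult_linear _ _ 1 Hb); intros n; pose proof (pos_INR n).
    rewrite Rabs_pos_eq; lra. }
  replace (PSeries (fun k => 2 * (alpha * INR k + alpha - 1) * b k) y)
    with ((2 * alpha - 2) * PSeries b y + 2 * alpha * (y * PSeries (PS_derive b) y)).
  - field; lra.
  - rewrite <- PSeries_incr_1, <- !PSeries_scal.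
    assert (E : forall k, PS_incr_1 (PS_derive b) k = INR k * b k).
    { intros [ | k]; [simpl; unfold zero; simpl; ring | reflexivity]. }
    rewrite <- PSeries_plus.
    + apply PSeries_ext; intros k.
      unfold PS_plus, PS_scal, plus, scal; simpl; unfold mult; simpl; rewrite E; ring.
    + apply ex_pseries_scal; [intros; apply Rmult_comm | apply entire_ex_pseries, Hb].
    + apply ex_pseries_scal; [apply Rmult_comm | ].
      apply (ex_pseries_ext (fun k => INR k * b k)); [intros; symmetry; apply E | ].
      apply entire_ex_pseries, Hk.
Qed.

(** * Exchange of series and integral for positive order *)

Lemma Rpower_frac_pow u alpha k : 0 < u ->
  Rpower u (2 * alpha * INR k) = Rpower u (2 * alpha) ^ k.
Proof.
  intros Hu; rewrite <- Rpower_mult, Rpower_pow; [reflexivity | apply Rpower_pos].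
Qed.

Lemma EK_kernel_shift w g alpha k u : 0 < u ->
  EK_kernel w g (alpha * INR k + alpha) u
  = EK_kernel w g alpha u * Rpower u (2 * alpha) ^ k.
Proof.
  intros Hu; unfold EK_kernel; rewrite <- Rpower_frac_pow by exact Hu.
  replace (2 * (alpha * INR k + alpha) - 1) with (2 * alpha - 1 + 2 * alpha * INR k) by ring.
  rewrite Rpower_plus; ring.
Qed.

Lemma is_RInt_gen_sum_n {Fa Fb : (R -> Prop) -> Prop} {FFa : Filter Fa} {FFb : Filter Fb}
    (f : nat -> R -> R) (l : nat -> R) :
  (forall n, is_RInt_gen (f n) Fa Fb (l n)) ->
  forall n, is_RInt_gen (fun x => sum_n (fun k => f k x) n) Fa Fb (sum_n l n).
Proof.
  intros H; induction n as [ | n IH].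
  - rewrite sum_O.
    apply (is_RInt_gen_ext (V := R_NormedModule)) with (f := f O); [ | apply H].
    apply filter_forall; intros ab x _; rewrite sum_O; reflexivity.
  - rewrite sum_Sn.
    apply (is_RInt_gen_ext (V := R_NormedModule)) with (f := fun x => plus (sum_n (fun k => f k x) n) (f (S n) x)).
    + apply filter_forall; intros ab x _; rewrite sum_Sn; reflexivity.
    + apply (is_RInt_gen_plus (V := R_NormedModule) (fun x => sum_n (fun k => f k x) n) (f (S n))); [exact IH | apply H].
Qed.

Lemma Series_remainder (a : nat -> R) n : ex_series a ->
  Series a - sum_n a n = Series (fun k => a (S n + k)%nat).
Proof.
  intros Ha; rewrite (Series_incr_n a (S n)) by (auto; lia).
  simpl pred; rewrite <- sum_n_Reals; ring.
Qed.

(** The tail at [y] is dominated termwise by the absolute tail at [Y], so the bound is uniform on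
    $[0,Y]$. *)
Lemma PSeries_remainder_le b y Y n : entire b -> 0 <= y <= Y ->
  Rabs (PSeries b y - sum_n (fun k => b k * y ^ k) n)
  <= Series (fun k => Rabs (b k * Y ^ k)) - sum_n (fun k => Rabs (b k * Y ^ k)) n.
Proof.
  intros Hb Hy; unfold PSeries.
  pose proof (Hb Y) as HY; pose proof (Hb y) as Hy1; unfold CV_disk in *.
  rewrite !Series_remainder by (try exact HY; apply ex_series_Rabs; exact Hy1).
  eapply Rle_trans; [apply Series_Rabs | ].
  - apply (ex_series_incr_n (fun k => Rabs (b k * y ^ k)) (S n)), Hy1.
  - apply Series_le.
    + intros k; split; [apply Rabs_pos | ].
      rewrite !Rabs_mult; apply Rmult_le_compat_l; [apply Rabs_pos | ].
      rewrite !Rabs_pos_eq by (apply pow_le; lra); apply pow_incr, Hy.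
    + apply (ex_series_incr_n (fun k => Rabs (b k * Y ^ k)) (S n)), HY.
Qed.

(** For $p=\alpha k+\alpha$ the lower Wendel bound gives $p\,\Gamma(p)\le(p+1)\Gamma(p+g)$, and
    $(p+1)/p\le1+1/\alpha$ because $p\ge\alpha$. *)
Lemma Gamma_ratio_le alpha g k : 0 < alpha -> 0 < g <= 1 ->
  Gamma (alpha * INR k + alpha) / Gamma (alpha * INR k + alpha + g) <= 1 + / alpha.
Proof.
  intros Ha Hg; set (p := alpha * INR k + alpha).
  assert (Hpa : alpha <= p) by (unfold p; pose proof (pos_INR k); nra).
  pose proof (Gamma_cross p 1 g (p + 1) ltac:(lra) ltac:(lra) ltac:(lra) ltac:(lra) ltac:(lra)) as H.
  pose proof (Gamma_lower p g ltac:(lra) ltac:(lra)) as HL.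
  pose proof (Gamma_pos p ltac:(lra)); pose proof (Gamma_pos (p + g) ltac:(lra)) as HG.
  assert (HR : Rpower (p + g) (1 - g) <= p + 1).
  { eapply Rle_trans; [apply Rle_Rpower_l with (b := p + 1); lra | ].
    rewrite <- (Rpower_1 (p + 1)) at 2 by lra; apply Rle_Rpower; lra. }
  assert (H1 : p * Gamma p <= (p + 1) * Gamma (p + g)) by nra.
  apply Rmult_le_reg_r with (p * Gamma (p + g)); [apply Rmult_lt_0_compat; lra | ].
  replace (Gamma p / Gamma (p + g) * (p * Gamma (p + g))) with (p * Gamma p) by (field; lra).
  apply Rle_trans with (1 := H1).
  rewrite <- Rmult_assoc; apply Rmult_le_compat_r; [lra | ].
  assert (1 <= / alpha * p).
  { apply Rmult_le_compat_l with (r := / alpha) in Hpa; [ | left; apply Rinv_0_lt_compat, Ha].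
    rewrite Rinv_l in Hpa; lra. }
  lra.
Qed.

Lemma entire_Gamma_ratio alpha g b : 0 < alpha -> 0 < g <= 1 -> entire b ->
  entire (fun k => Gamma (alpha * INR k + alpha) / Gamma (alpha * INR k + alpha + g) * b k).
Proof.
  intros Ha Hg Hb; apply (entire_mult_linear _ _ (1 + / alpha) Hb); intros n.
  pose proof (Gamma_ratio_le alpha g n Ha Hg); pose proof (pos_INR n).
  assert (0 <= alpha * INR n) by nra.
  rewrite Rabs_pos_eq.
  - assert (0 < / alpha) by (apply Rinv_0_lt_compat, Ha); nra.
  - left; apply Rdiv_lt_0_compat; apply Gamma_pos; lra.
Qed.

(** By [EK_kernel_shift] all terms share the integrable weight [EK_kernel w g alpha], against which
    the power series in $u^{2\alpha}$ converges uniformly. The prefactor of [EK_pos] cancels the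
    $w^{2g}\Gamma(g)$ in every moment. *)
Lemma EK_pos_frac_series alpha g b f w : 0 < alpha -> 0 < g <= 1 -> entire b ->
  (forall x, 0 < x -> f x = frac_series alpha b x) -> 0 < w ->
  EK_pos 2 0 g f w
  = frac_series alpha
      (fun k => Gamma (alpha * INR k + alpha) / Gamma (alpha * INR k + alpha + g) * b k) w.
Proof.
  intros Ha Hg Hb Hf Hw.
  set (b' := fun k => Gamma (alpha * INR k + alpha) / Gamma (alpha * INR k + alpha + g) * b k).
  assert (Hb' : entire b') by exact (entire_Gamma_ratio alpha g b Ha Hg Hb).
  pose proof (improper_ends_0_left w Hw) as HD.
  pose proof (Gamma_pos g (proj1 Hg)) as HGg.
  set (Y := Rpower w (2 * alpha)).
  assert (HI : is_RInt_gen (fun u => EK_kernel w g alpha u * PSeries b (Rpower u (2 * alpha)))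
     (at_right 0) (at_left w) (Rpower w (2 * g) * Gamma g * frac_series alpha b' w)).
  { apply (is_RInt_gen_weighted_limit (fun u => 0 < u < w) _ _ _ (EK_kernel w g alpha)
      (fun n u => sum_n (fun k => b k * EK_kernel w g (alpha * INR k + alpha) u) n)
      (fun n => Series (fun k => Rabs (b k * Y ^ k)) - sum_n (fun k => Rabs (b k * Y ^ k)) n)
      (fun n => sum_n (fun k => b k * EK_moment w g (alpha * INR k + alpha)) n)
      (EK_moment w g alpha)); [exact HD | | | | | | ].
    - intros u Hu; apply (continuous_mult (K := R_AbsRing)).
      + apply continuous_EK_kernel, Hu.
      + apply (continuous_comp (fun u => Rpower u (2 * alpha)) (PSeries b)).
        * apply continuous_Rpower; lra.
        * apply (ex_derive_continuous (V := R_NormedModule)).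
          eexists; apply is_derive_PSeries, entire_CV_radius, Hb.
    - apply is_RInt_gen_EK_kernel; lra.
    - apply (is_RInt_gen_sum_n (fun k u => b k * EK_kernel w g (alpha * INR k + alpha) u)
               (fun k => b k * EK_moment w g (alpha * INR k + alpha))).
      intros k; apply (is_RInt_gen_scal (V := R_NormedModule)), is_RInt_gen_EK_kernel; try lra.
      pose proof (pos_INR k); nra.
    - apply (is_series_ext (fun k => (Rpower w (2 * g) * Gamma g * Rpower w (2 * alpha - 2))
                                     * (b' k * Y ^ k))).
      + intros k; unfold b', Y, EK_moment.
        replace (2 * (g + (alpha * INR k + alpha) - 1))
          with (2 * g + (2 * alpha - 2) + 2 * alpha * INR k) by ring.
        rewrite 2!Rpower_plus, Rpower_frac_pow by exact Hw.
        replace (g + (alpha * INR k + alpha)) with (alpha * INR k + alpha + g) by ring.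
        pose proof (pos_INR k); pose proof (Gamma_pos (alpha * INR k + alpha + g) ltac:(nra)).
        match goal with |- ?x = ?y => change (@eq R x y) end; field; lra.
      + unfold frac_series; fold Y; rewrite <- Rmult_assoc.
        apply (is_series_scal (V := R_NormedModule) _ (fun k => b' k * Y ^ k)), Series_correct.
        apply ex_series_Rabs, Hb'.
    - replace 0 with (Series (fun k => Rabs (b k * Y ^ k)) - Series (fun k => Rabs (b k * Y ^ k)))
        by ring.
      apply is_lim_seq_minus'; [apply is_lim_seq_const | ].
      apply Series_correct, Hb.
    - intros n u Hu.
      replace (sum_n (fun k => b k * EK_kernel w g (alpha * INR k + alpha) u) n)
        with (EK_kernel w g alpha u * sum_n (fun k => b k * Rpower u (2 * alpha) ^ k) n).
      + rewrite <- Rmult_minus_distr_l, Rabs_mult, Rmult_comm.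
        pose proof (EK_kernel_pos w g alpha u).
        rewrite (Rabs_pos_eq (EK_kernel w g alpha u)) by lra.
        apply Rmult_le_compat_r; [lra | ].
        apply PSeries_remainder_le; [exact Hb | split; [left; apply Rpower_pos | ]].
        apply Rle_Rpower_l; lra.
      + rewrite <- (sum_n_mult_l (K := R_Ring)); apply sum_n_ext; intros k.
        rewrite EK_kernel_shift by lra; unfold mult; simpl; ring. }
  unfold EK_pos.
  rewrite (is_RInt_gen_unique (V := R_CompleteNormedModule) _
             (Rpower w (2 * g) * Gamma g * frac_series alpha b' w)).
  - replace (- (2) * 0 - 2 * g) with (- (2 * g)) by ring; rewrite Rpower_Ropp.
    pose proof (Rpower_pos w (2 * g)); field; lra.
  - refine (is_RInt_gen_ext_ends _ _ _ _ _ _ HD _ HI).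
    intros u Hu; rewrite Hf by lra; unfold EK_kernel, frac_series.
    rewrite !Rpower_2, Rmult_0_r, Rpower_O by lra.
    (* The exponent is that of [frac_series] plus the one from $d(u^2)=2u\,du$. *)
    replace (2 * alpha - 1) with (2 * alpha - 2 + (2 - 1)) by ring.
    rewrite Rpower_plus; ring.
Qed.

(** * Diagonal action at nonpositive order *)

(** The continuation of $\Gamma(x_k)/\Gamma(x_k+a)$ to $a\le0$, $x_k=\alpha k+\alpha$, written as a
    product because [Gamma] is an integral that represents the Gamma function only at positive
    arguments. *)
Fixpoint EK_multiplier (n : nat) (alpha a : R) (k : nat) : R :=
  match n with
  | O => Gamma (alpha * INR k + alpha) / Gamma (alpha * INR k + alpha + a)
  | S n' => (a + (alpha * INR k + alpha)) * EK_multiplier n' alpha (a + 1) k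
  end.

Lemma entire_EK_multiplier alpha n : forall a b, 0 < alpha -> 0 < a + INR n <= 1 -> entire b ->
  entire (fun k => EK_multiplier n alpha a k * b k).
Proof.
  induction n as [ | n IH]; intros a b Ha Hn Hb.
  - rewrite Rplus_0_r in Hn; apply entire_Gamma_ratio; assumption.
  - rewrite S_INR in Hn.
    assert (H : entire (fun k => (a + (alpha * INR k + alpha))
                                  * (EK_multiplier n alpha (a + 1) k * b k))).
    { apply (entire_mult_linear _ _ (Rabs a + alpha)).
      - apply IH; [exact Ha | lra | exact Hb].
      - intros k; pose proof (pos_INR k); pose proof (Rabs_pos a).
        eapply Rle_trans; [apply Rabs_triang | ].
        rewrite (Rabs_pos_eq (alpha * INR k + alpha)) by nra; nra. }
    intros r; apply (ex_series_ext _ _ (fun k => f_equal Rabs (f_equal (fun x => x * r ^ k)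
      (eq_sym (Rmult_assoc _ _ _)))) (H r)).
Qed.

Lemma frac_series_lincomb alpha b1 b2 x y w : entire b1 -> entire b2 ->
  x * frac_series alpha b1 w + y * frac_series alpha b2 w
  = frac_series alpha (fun k => x * b1 k + y * b2 k) w.
Proof.
  intros H1 H2; unfold frac_series.
  set (z := Rpower w (2 * alpha)).
  replace (PSeries (fun k => x * b1 k + y * b2 k) z) with (x * PSeries b1 z + y * PSeries b2 z).
  - ring.
  - rewrite <- !PSeries_scal; symmetry.
    apply (PSeries_plus (PS_scal x b1) (PS_scal y b2));
      apply ex_pseries_scal; try apply Rmult_comm; apply entire_ex_pseries; assumption.
Qed.

Lemma frac_series_ext alpha b1 b2 w : (forall k, b1 k = b2 k) ->
  frac_series alpha b1 w = frac_series alpha b2 w.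
Proof. intros H; unfold frac_series; f_equal; apply PSeries_ext, H. Qed.

Lemma EK_iter_frac_series alpha n : forall a b f w,
  0 < alpha -> 0 < a + INR n <= 1 -> entire b ->
  (forall x, 0 < x -> f x = frac_series alpha b x) -> 0 < w ->
  EK_iter n 2 0 a f w = frac_series alpha (fun k => EK_multiplier n alpha a k * b k) w.
Proof.
  induction n as [ | n IH]; intros a b f w Ha Hn Hb Hf Hw.
  - rewrite Rplus_0_r in Hn; apply EK_pos_frac_series; assumption.
  - rewrite S_INR in Hn; simpl.
    assert (Hxb : entire (fun k => 2 * (alpha * INR k + alpha - 1) * b k)).
    { apply (entire_mult_linear _ _ (2 * (alpha + 1)) Hb); intros k; pose proof (pos_INR k).
      apply Rabs_le; split; nra. }
    rewrite (IH (a + 1) b f) by (try assumption; lra).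
    rewrite (IH (a + 1) _ (xD f) w Ha ltac:(lra) Hxb
               (fun x Hx => xD_frac_series alpha b f x Hb Hf Hx) Hw).
    rewrite frac_series_lincomb by (apply entire_EK_multiplier; try assumption; lra).
    (* The two branches add up: $(a+1)+\frac12\cdot2(\alpha k+\alpha-1)=a+\alpha k+\alpha$. *)
    apply frac_series_ext; intros k; field.
Qed.

(** [up] lies strictly above its argument, by at most 1; so at $\alpha=1$ the final order is 1,
    reached in two steps. *)
Lemma EK_steps_opp alpha : 0 < alpha <= 1 -> 0 < - alpha + INR (EK_steps (- alpha)) <= 1.
Proof.
  intros Ha; unfold EK_steps; rewrite Ropp_involutive.
  destruct (archimed alpha) as [H1 H2].
  rewrite INR_IZR_INZ, Z2Nat.id; [lra | ].
  apply le_IZR; lra.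
Qed.

(** For $\alpha<1$ a single step contributes $\alpha k$. For $\alpha=1$ the second step contributes
    $k+1$, absorbed by $\Gamma(k+2)=(k+1)\Gamma(k+1)$. Keeping $\alpha k$ apart from $\Gamma(\alpha
    k+1)$ covers $k=0$. *)
Lemma EK_multiplier_steps alpha k : 0 < alpha <= 1 ->
  EK_multiplier (EK_steps (- alpha)) alpha (- alpha) k
  = alpha * INR k * Gamma (alpha * INR k + alpha) / Gamma (alpha * INR k + 1).
Proof.
  intros Ha; pose proof (pos_INR k).
  assert (0 <= alpha * INR k) by nra.
  pose proof (Gamma_pos (alpha * INR k + 1) ltac:(lra)).
  destruct (Rle_lt_or_eq_dec _ _ (proj2 Ha)) as [Hlt | ->].
  - replace (EK_steps (- alpha)) with 1%nat.
    + simpl; replace (alpha * INR k + alpha + (- alpha + 1)) with (alpha * INR k + 1) by ring.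
      field; lra.
    + unfold EK_steps; rewrite Ropp_involutive, <- (tech_up alpha 1); [reflexivity | lra | lra].
  - replace (EK_steps (- (1))) with 2%nat.
    + cbn [EK_multiplier]; replace (1 * INR k + 1 + (- (1) + 1 + 1)) with (1 * INR k + 1 + 1) by ring.
      rewrite (Gamma_succ (1 * INR k + 1)) by lra; field; lra.
    + unfold EK_steps; rewrite Ropp_involutive, <- (tech_up 1 2); [reflexivity | lra | lra].
Qed.

(** As $\alpha(k+1)=\alpha k+\alpha$, the functional equation leaves the Gamma value of the
    preceding index in the denominator; this is what shifts the series. *)
Lemma EK_multiplier_steps_S alpha k : 0 < alpha <= 1 ->
  EK_multiplier (EK_steps (- alpha)) alpha (- alpha) (S k)
  = Gamma (alpha * INR (S k) + alpha) / Gamma (alpha * INR k + alpha).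
Proof.
  intros Ha; rewrite EK_multiplier_steps by exact Ha.
  rewrite S_INR; pose proof (pos_INR k).
  assert (0 <= alpha * INR k) by nra.
  replace (alpha * (INR k + 1) + 1) with (alpha * INR k + alpha + 1) by ring.
  rewrite Gamma_succ by lra.
  pose proof (Gamma_pos (alpha * INR k + alpha) ltac:(lra)); field; lra.
Qed.

(** * Convergence of the series of the solution *)

Lemma is_lim_Rpower_opp s : 0 < s ->
  filterlim (fun x => Rpower x (- s)) (Rbar_locally p_infty) (locally 0).
Proof.
  intros Hs; apply filterlim_locally; intros [e He].
  exists (Rpower e (- / s)); intros x Hx; change (Rabs (Rpower x (- s) - 0) < e).
  pose proof (Rpower_pos e (- / s)).
  rewrite Rminus_0_r, Rabs_pos_eq by (left; apply Rpower_pos).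
  replace e with (Rpower (Rpower e (- / s)) (- s)).
  - rewrite !(Rpower_Ropp _ s); apply Rinv_lt_contravar.
    + apply Rmult_lt_0_compat; apply Rpower_pos.
    + apply Rlt_Rpower_l; lra.
  - rewrite Rpower_mult; replace (- / s * - s) with 1 by (field; lra); apply Rpower_1, He.
Qed.

(** Ratio test. With $p=\alpha k+\alpha$, the lower Wendel bound gives
    $\Gamma(p)/\Gamma(p+\alpha)\le(p+\alpha)^{1-\alpha}/p\le2(p+\alpha)^{-\alpha}$, the 2 coming
    from $p+\alpha\le2p$. *)
Lemma entire_inv_Gamma_sqr alpha : 0 < alpha <= 1 ->
  entire (fun k => / Gamma (alpha * INR k + alpha) ^ 2).
Proof.
  intros Ha r.
  assert (HG : forall k, 0 < Gamma (alpha * INR k + alpha))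
    by (intros k; pose proof (pos_INR k); apply Gamma_pos; nra).
  apply (CV_disk_DAlembert _ _ 0); [ | | left; reflexivity].
  - intros n; specialize (HG n); apply Rinv_neq_0_compat, pow_nonzero; lra.
  - set (q := fun k => Gamma (alpha * INR k + alpha) / Gamma (alpha * INR (S k) + alpha)).
    apply (is_lim_seq_ext (fun k => q k * q k)).
    { intros k; pose proof (HG k); pose proof (HG (S k)).
      rewrite Rabs_pos_eq; unfold q; [field; split; lra | ].
      left; apply Rdiv_lt_0_compat; apply Rinv_0_lt_compat, pow_lt; assumption. }
    assert (Hq : is_lim_seq q 0).
    { apply (is_lim_seq_le_le (fun _ => 0) q (fun k => 2 * Rpower (alpha * INR k + 2 * alpha) (- alpha))).
      - intros k; pose proof (HG k); pose proof (HG (S k)); split.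
        { left; apply Rdiv_lt_0_compat; assumption. }
        unfold q; rewrite S_INR in *; pose proof (pos_INR k).
        assert (0 <= alpha * INR k) by nra.
        set (p := alpha * INR k + alpha) in *.
        assert (Hp : 0 < p) by (unfold p; lra).
        replace (alpha * (INR k + 1) + alpha) with (p + alpha) in * by (unfold p; ring).
        replace (alpha * INR k + 2 * alpha) with (p + alpha) by (unfold p; ring).
        pose proof (Gamma_lower p alpha Hp ltac:(lra)) as HL.
        replace (1 - alpha) with (1 + - alpha) in HL by ring.
        rewrite Rpower_plus, Rpower_1 in HL by lra.
        pose proof (Rpower_pos (p + alpha) (- alpha)).
        apply Rmult_le_reg_r with (p * Gamma (p + alpha)); [apply Rmult_lt_0_compat; lra | ].
        replace (Gamma p / Gamma (p + alpha) * (p * Gamma (p + alpha))) with (p * Gamma p)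
          by (field; lra).
        apply Rle_trans with (1 := HL).
        replace (2 * Rpower (p + alpha) (- alpha) * (p * Gamma (p + alpha)))
          with ((2 * p) * Rpower (p + alpha) (- alpha) * Gamma (p + alpha)) by ring.
        apply Rmult_le_compat_r; [lra | ]; apply Rmult_le_compat_r; [lra | unfold p; lra].
      - apply is_lim_seq_const.
      - replace (Finite 0) with (Rbar_mult 2 0) by (simpl; f_equal; ring).
        apply is_lim_seq_scal_l.
        apply (filterlim_comp _ _ _ (fun k => alpha * INR k + 2 * alpha)
                 (fun x => Rpower x (- alpha)) _ (Rbar_locally p_infty)).
        2: apply is_lim_Rpower_opp; lra.
        intros P [M HM]; destruct (INR_unbounded (M / alpha)) as [N HN].
        exists N; intros n Hn; apply HM; apply le_INR in Hn.
        assert (M / alpha * alpha < INR n * alpha) by (apply Rmult_lt_compat_r; lra).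
        replace (M / alpha * alpha) with M in * by (field; lra); lra. }
    replace 0 with (0 * 0) by ring; apply is_lim_seq_mult'; exact Hq.
Qed.

Definition u_coef (alpha lambda c : R) (k : nat) : R :=
  (-1) ^ k * (lambda / (Rpower 2 alpha * Rpower c alpha)) ^ (2 * k)
  / Gamma (alpha * INR k + alpha) ^ 2.

Lemma u_sol_frac_series alpha lambda c w : 0 < alpha -> 0 < w ->
  u_sol alpha lambda c w = frac_series alpha (u_coef alpha lambda c) w.
Proof.
  intros Ha Hw; unfold u_sol, frac_series, PSeries; f_equal.
  apply Series_ext; intros k; unfold u_coef; rewrite <- Rpower_frac_pow by exact Hw.
  unfold Rdiv; ring.
Qed.

(** The signs and powers of $\mu$ are absorbed into the argument $-\mu^2r$. *)
Lemma entire_u_coef alpha lambda c : 0 < alpha <= 1 -> entire (u_coef alpha lambda c).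
Proof.
  intros Ha r; set (mu := lambda / (Rpower 2 alpha * Rpower c alpha)).
  pose proof (entire_inv_Gamma_sqr alpha Ha (- mu ^ 2 * r)) as H; unfold CV_disk in *.
  apply (ex_series_ext _ _) with (2 := H); intros k; f_equal; unfold u_coef; fold mu.
  replace (- mu ^ 2 * r) with (-1 * mu ^ 2 * r) by ring.
  rewrite !Rpow_mult_distr, <- pow_mult; unfold Rdiv; ring.
Qed.

(** * The fractional Bessel equation *)

Theorem theorem3p1 (alpha lambda c : R) :
  0 < alpha <= 1 -> 0 < c ->
  forall w : R, 0 < w ->
    LB_frac alpha (u_sol alpha lambda c) w
    = - (lambda ^ 2 / Rpower c (2 * alpha)) * u_sol alpha lambda c w.
Proof.
  intros Ha Hc w Hw.
  set (n := EK_steps (- alpha)).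
  set (rho := EK_multiplier n alpha (- alpha)).
  set (b := u_coef alpha lambda c).
  assert (Hn : 0 < - alpha + INR n <= 1) by (apply EK_steps_opp, Ha).
  assert (Hb : entire b) by (apply entire_u_coef, Ha).
  assert (Hrb : entire (fun k => rho k * b k)) by (apply entire_EK_multiplier; (assumption || apply Ha)).
  assert (Hrrb : entire (fun k => rho k * (rho k * b k)))
    by (apply (entire_EK_multiplier alpha n (- alpha) (fun k => rho k * b k));
        (assumption || apply Ha)).
  assert (H1 : forall x, 0 < x ->
     EK 2 0 (- alpha) (u_sol alpha lambda c) x = frac_series alpha (fun k => rho k * b k) x).
  { intros x Hx; apply EK_iter_frac_series; try (assumption || apply Ha).
    intros y Hy; apply u_sol_frac_series; [apply Ha | exact Hy]. }
  unfold LB_frac, EK at 1; fold n.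
  rewrite (EK_iter_frac_series alpha n _ _ _ w (proj1 Ha) Hn Hrb H1 Hw).
  rewrite u_sol_frac_series by (apply Ha || exact Hw); fold b rho.
  unfold frac_series; set (y := Rpower w (2 * alpha)).
  set (mu := lambda / (Rpower 2 alpha * Rpower c alpha)).
  assert (Hrho0 : rho O = 0).
  { unfold rho, n; rewrite EK_multiplier_steps by exact Ha; simpl; unfold Rdiv; ring. }
  (* The squared multiplier replaces $1/\Gamma(\alpha(k+1)+\alpha)^2$ by $1/\Gamma(\alpha
     k+\alpha)^2$. The shift leaves over $-\mu^2$, which becomes the eigenvalue, and one [y], which
     the $w^{-2\alpha}$ of [LB_frac] cancels. *)
  assert (Hshift : PSeries (fun k => rho k * (rho k * b k)) y = y * (- mu ^ 2 * PSeries b y)).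
  { rewrite PSeries_decr_1 by (apply entire_ex_pseries, Hrrb).
    rewrite Hrho0, <- (PSeries_scal (- mu ^ 2)), Rmult_0_l, Rplus_0_l; f_equal.
    apply PSeries_ext; intros k; unfold PS_decr_1, PS_scal, rho, n, b, u_coef; fold mu.
    rewrite EK_multiplier_steps_S by exact Ha.
    pose proof (pos_INR k); pose proof (pos_INR (S k)).
    pose proof (Gamma_pos (alpha * INR k + alpha) ltac:(nra)).
    pose proof (Gamma_pos (alpha * INR (S k) + alpha) ltac:(nra)).
    set (G0 := Gamma (alpha * INR k + alpha)) in *.
    set (G1 := Gamma (alpha * INR (S k) + alpha)) in *.
    replace (2 * S k)%nat with (2 + 2 * k)%nat by lia.
    rewrite pow_add; unfold scal; simpl; unfold mult; simpl; field; lra. }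
  rewrite Hshift.
  replace (-2 * alpha) with (- (2 * alpha)) by ring; rewrite Rpower_Ropp; fold y.
  assert (Hy : 0 < y) by apply Rpower_pos.
  (* The $2^\alpha$ inside $\mu$ is there to cancel the $4^\alpha$ of the operator. *)
  assert (Hmu : Rpower 4 alpha * mu ^ 2 = lambda ^ 2 / Rpower c (2 * alpha)).
  { unfold mu.
    replace (Rpower c (2 * alpha)) with (Rpower c alpha * Rpower c alpha)
      by (rewrite <- Rpower_plus; f_equal; ring).
    replace (Rpower 4 alpha) with (Rpower 2 alpha * Rpower 2 alpha)
      by (rewrite Rpower_mult_distr by lra; f_equal; ring).
    pose proof (Rpower_pos 2 alpha); pose proof (Rpower_pos c alpha); field; lra. }
  rewrite <- Hmu; field; lra.
Qed.
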